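(* Let $X$ be an infinite-dimensional complex Banach space and $T\in L(X)$. The following conditions are mutually equivalent: (i) there exists $(M,N)\in Red(T)$ such that $T_M$ is invertible and $T_N$ is meromorphic; (ii) $T$ admits a generalized Kato-meromorphic decomposition and $0\notin\mathrm{int}\,\sigma(T)$; (iii) $T$ admits a generalized Kato-meromorphic decomposition, and $T$ and $T'$ have the SVEP at $0$; (iv) $T$ is generalized Drazin-meromorphic invertible; (v) $T$ is meromorphic quasi-polar; (vi) there exists a projection $P\in L(X)$ such that $P$ commutes with $T$, $TP$ is meromorphic and $T+P$ is B-Browder; (vii) there exists a projection $P\in L(X)$ which commutes with $T$ and such that $TP$ is meromorphic and $T(I-P)+P$ is B-Browder; (viii) there exists $(M,N)\in Red(T)$ such that $T_M$ is B-Browder and $T_N$ is meromorphic; (ix) $T$ admits a generalized Kato-meromorphic decomposition and $0\notin\mathrm{acc}\,\sigma_{B\mathcal B}(T)$; (x) $T$ admits a generalized Kato-meromorphic decomposition and $0\notin\mathrm{int}\,\sigma_{B\mathcal B}(T)$.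
   Context: $L(X)$ is the algebra of bounded linear operators on $X$; $T'$ is the dual (adjoint) operator on $X'$; $N(T)$, $R(T)$ are kernel and range; $\sigma(T)$ is the spectrum; $\mathrm{int}\,K$ and $\mathrm{acc}\,K$ are the sets of interior and accumulation points of $K\subset\mathbb C$. $(M,N)\in Red(T)$ means that $M,N$ are closed $T$-invariant subspaces with $X=M\oplus N$; $T_M$, $T_N$ are the restrictions of $T$ viewed as operators on $M$, $N$. All operator classes are defined in the same way on any Banach space. $T$ is Kato if $R(T)$ is closed and $N(T)\subset R(T^n)$ for every $n\in\mathbb N$. An operator is meromorphic if every non-zero point of its spectrum is a pole of its resolvent. $T$ admits a generalized Kato-meromorphic decomposition if there is $(M,N)\in Red(T)$ with $T_M$ Kato and $T_N$ meromorphic. $T$ is generalized Drazin-meromorphic invertible if there is $S\in L(X)$ with $TS=ST$, $STS=S$ and $TST-T$ meromorphic. $T$ is meromorphic quasi-polar if there is a bounded projection $Q$ with $TQ=QT$, $T(I-Q)$ meromorphic, and $Q\in (L(X)T)\cap(TL(X))$ (i.e. $Q=UT=TV$ for some $U,V\in L(X)$). $T$ is Browder if it is Fredholm with finite ascent and finite descent. $T$ is B-Browder if there is an integer $n\ge 0$ such that $R(T^n)$ is closed and the restriction of $T$ to $R(T^n)$, viewed as a map $R(T^n)\to R(T^n)$, is Browder; it is known that this is equivalent to $T$ being Drazin invertible (finite ascent and descent). $\sigma_{B\mathcal B}(T)=\{\lambda\in\mathbb C: T-\lambda I\text{ is not B-Browder}\}$. $T$ has the SVEP (single-valued extension property) at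 $\lambda_0\in\mathbb C$ if for every open disc $\mathcal D_{\lambda_0}$ centered at $\lambda_0$ the only analytic function $f:\mathcal D_{\lambda_0}\to X$ satisfying $(T-\lambda)f(\lambda)=0$ for all $\lambda\in\mathcal D_{\lambda_0}$ is $f\equiv 0$. *)

(* Defs.v *)
From HB Require Import structures.
From mathcomp Require Import all_boot all_order all_algebra.
From mathcomp Require Import complex.
From mathcomp Require Import all_classical all_reals all_analysis.

Set Implicit Arguments.
Unset Strict Implicit.
Unset Printing Implicit Defensive.

Import Order.TTheory GRing.Theory Num.Theory.
Import numFieldNormedType.Exports.

Local Open Scope classical_set_scope.
Local Open Scope complex_scope.
Local Open Scope ring_scope.

Definition bop_pred (R : realType) (X Y : normedModType R[i]) : {pred X -> Y} :=
  fun f => `[< linear f /\ continuous f >].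

(* bop X Y is L(X, Y); by linear_bounded_continuous, a linear map is bounded
   iff it is continuous. *)
Record bop (R : realType) (X Y : normedModType R[i]) := Bop {
  bop_fun :> X -> Y;
  bop_funP : bop_fun \in @bop_pred R X Y }.

Section BopLmodule.
Context {R : realType} {X Y : normedModType R[i]}.

HB.instance Definition _ := [isSub of bop X Y for @bop_fun R X Y].
HB.instance Definition _ := gen_eqMixin (bop X Y).
HB.instance Definition _ := gen_choiceMixin (bop X Y).

Lemma bopE (f : X -> Y) :
  reflect (linear f /\ continuous f) (f \in @bop_pred R X Y).
Proof. exact: asboolP. Qed.

Lemma bop_submod_closed : submod_closed (@bop_pred R X Y).
Proof.
split.
  by apply/bopE; split=> [a x y|x]; [rewrite /= scaler0 addr0|exact: cvg_cst].
move=> a f g /bopE[lf cf] /bopE[lg cg]; apply/bopE; split=> [b x y|x].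
  rewrite -[(a *: f + g) _]/(a *: f _ + g _) -[(a *: f + g) x]/(a *: f x + g x).
  rewrite -[(a *: f + g) y]/(a *: f y + g y) lf lg !scalerDr !scalerA mulrC.
  by rewrite addrACA.
by apply: cvgD; [apply: cvgZr; exact: cf|exact: cg].
Qed.

HB.instance Definition _ :=
  GRing.isSubmodClosed.Build _ _ (@bop_pred R X Y) bop_submod_closed.
HB.instance Definition _ := [SubChoice_isSubLmodule of bop X Y by <:].

End BopLmodule.

Section BopTheory.
Context {R : realType} {X Y : normedModType R[i]}.
Implicit Types T S : bop X Y.

Lemma bop_linear T : linear T.
Proof. by case/bopE: (bop_funP T). Qed.

HB.instance Definition _ T :=
  GRing.isLinear.Build R[i] X Y *:%R (bop_fun T) (bop_linear T).

Lemma bop_continuous T : continuous T.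
Proof. by case/bopE: (bop_funP T). Qed.

Lemma bop_ext T S : (forall x, T x = S x) -> T = S.
Proof. by move=> h; apply/val_inj/funext. Qed.

Lemma bop0E x : (0 : bop X Y) x = 0.
Proof. by []. Qed.

Lemma bopDE T S x : (T + S) x = T x + S x.
Proof. by []. Qed.

Lemma bopNE T x : (- T) x = - T x.
Proof. by []. Qed.

Lemma bopZE a T x : (a *: T) x = a *: T x.
Proof. by []. Qed.

Lemma bop_bounded T : exists2 k : R, 0 <= k & forall x, `|T x| <= k%:C * `|x|.
Proof.
have /linear_bounded_continuous/linear_boundedP/pinfty_ex_gt0[k k0 kT] :=
  @bop_continuous T.
have kR : (complex.Re k)%:C = k.
  by case: k k0 {kT} => a b /=; rewrite ltcE /= => /andP[/eqP -> _].
exists (complex.Re k) => [|x]; last by rewrite kR; exact: kT.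
by rewrite -lecR kR; exact: ltW.
Qed.

(* Norms of normed modules over R[i] take their values in R[i], so the real
   supremum is embedded by %:C. *)
Definition opnorm T : R[i] :=
  (sup [set complex.Re `|T x| | x in [set x | `|x| <= 1]])%:C.

Lemma ReK_norm (V : normedModType R[i]) (v : V) : (complex.Re `|v|)%:C = `|v|.
Proof.
by have := normr_ge0 v; case: `|v| => a b; rewrite lecE /= => /andP[/eqP ->].
Qed.

Lemma ler_opnorm T x : `|T x| <= opnorm T * `|x|.
Proof.
have [->|x0] := eqVneq x 0; first by rewrite linear0 !normr0 mulr0.
have nx : 0 < `|x| by rewrite normr_gt0.
rewrite -ler_pdivrMr // /opnorm.
set y := `|x|^-1 *: x.
have -> : `|T x| / `|x| = (complex.Re `|T y|)%:C.
  by rewrite ReK_norm /y linearZ /= normrZ normfV normr_id mulrC.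
rewrite lecR; apply: ub_le_sup; last first.
  by exists y => //=; rewrite /y normfZV.
have [k k0 kT] := bop_bounded T.
exists k => _ [z z1 <-]; rewrite -lecR ReK_norm (le_trans (kT z)) //.
by rewrite ler_piMr // lecR.
Qed.

Lemma opnorm_le T (k : R[i]) :
  0 <= k -> (forall x, `|T x| <= k * `|x|) -> opnorm T <= k.
Proof.
move=> k0 kT.
have kR : (complex.Re k)%:C = k.
  by case: k k0 {kT} => a b; rewrite lecE /= => /andP[/eqP ->].
rewrite -kR lecR; apply: ge_sup.
  by exists (complex.Re `|T 0|), 0 => //=; rewrite normr0.
move=> _ [z z1 <-]; rewrite -lecR ReK_norm kR (le_trans (kT z)) //.
by rewrite ler_piMr.
Qed.

Lemma opnorm_ge0 T : 0 <= opnorm T.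
Proof.
rewrite lecR; apply: ub_le_sup; last first.
  by exists 0; rewrite /= ?normr0 // linear0 normr0.
have [k k0 kT] := bop_bounded T.
exists k => _ [z z1 <-]; rewrite -lecR ReK_norm (le_trans (kT z)) //.
by rewrite ler_piMr // lecR.
Qed.

Lemma opnormD T S : opnorm (T + S) <= opnorm T + opnorm S.
Proof.
apply: opnorm_le => [|x]; first by rewrite addr_ge0 ?opnorm_ge0.
by rewrite bopDE (le_trans (ler_normD _ _)) // mulrDl lerD ?ler_opnorm.
Qed.

Lemma opnormZ_le a T : opnorm (a *: T) <= `|a| * opnorm T.
Proof.
apply: opnorm_le => [|x]; first by rewrite mulr_ge0 ?opnorm_ge0.
by rewrite bopZE normrZ -mulrA ler_wpM2l ?ler_opnorm.
Qed.

Lemma opnormZ a T : opnorm (a *: T) = `|a| * opnorm T.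
Proof.
apply/eqP; rewrite eq_le opnormZ_le /=; have [->|a0] := eqVneq a 0.
  by rewrite normr0 mul0r opnorm_ge0.
rewrite -ler_pdivlMl ?normr_gt0 // -normfV.
by rewrite -[X in opnorm X](scalerK a0) opnormZ_le.
Qed.

Lemma opnorm_eq0 T : opnorm T = 0 -> T = 0.
Proof.
move=> T0; apply: bop_ext => x; apply/eqP; rewrite -normr_le0.
by rewrite (le_trans (ler_opnorm T x)) // T0 mul0r.
Qed.

HB.instance Definition _ :=
  Lmodule_isNormed.Build R[i] (bop X Y) opnormD opnormZ opnorm_eq0.

Lemma bop_normE T : `|T| = opnorm T.
Proof. by []. Qed.

Lemma bounded_bopP (f : X -> Y) (k : R[i]) : linear f -> 0 <= k ->
  (forall x, `|f x| <= k * `|x|) -> f \in @bop_pred R X Y.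
Proof.
move=> lf k0 kf; apply/bopE; split=> //.
pose F : {linear X -> Y} := HB.pack f (GRing.isLinear.Build _ _ _ _ f lf).
apply/(linear_bounded_continuous F)/linear_boundedP; near=> r => x.
apply: (le_trans (kf x)); rewrite ler_wpM2r //.
by near: r; apply: nbhs_pinfty_ge; exact: ger0_real.
Unshelve. all: by end_near. Qed.

End BopTheory.

Section BopRing.
Context {R : realType} {X : normedModType R[i]}.
Implicit Types S T U : bop X X.

Lemma bop_comp_subproof T S : T \o S \in @bop_pred R X X.
Proof.
apply/bopE; split=> [a x y|x]; first by rewrite /= !linearP.
by apply: continuous_comp; exact: bop_continuous.
Qed.

Definition bop_comp T S : bop X X := Bop (bop_comp_subproof T S).

Lemma bop_id_subproof : idfun \in @bop_pred R X X.
Proof. by apply/bopE; split=> // x; exact: cvg_id. Qed.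

Definition bop_id : bop X X := Bop bop_id_subproof.

Lemma bop_compA : associative bop_comp.
Proof. by move=> T S U; exact: bop_ext. Qed.

Lemma bop_comp1l : left_id bop_id bop_comp.
Proof. by move=> T; exact: bop_ext. Qed.

Lemma bop_comp1r : right_id bop_id bop_comp.
Proof. by move=> T; exact: bop_ext. Qed.

Lemma bop_compDl : left_distributive bop_comp +%R.
Proof. by move=> T S U; exact: bop_ext. Qed.

Lemma bop_compDr : right_distributive bop_comp +%R.
Proof. by move=> T S U; apply: bop_ext => x; rewrite /= linearD. Qed.

HB.instance Definition _ := GRing.Zmodule_isPzRing.Build (bop X X)
  bop_compA bop_comp1l bop_comp1r bop_compDl bop_compDr.

Lemma bopME T S x : (T * S) x = T (S x).
Proof. by []. Qed.

Lemma bop1E x : (1 : bop X X) x = x.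
Proof. by []. Qed.

Lemma bopXE T n x : (T ^+ n) x = iter n T x.
Proof. by elim: n => [//|n IHn]; rewrite exprS bopME IHn. Qed.

End BopRing.

Definition dual (R : realType) (X : normedModType R[i]) : normedModType R[i] :=
  bop X R[i]^o.

Section Adjoint.
Context {R : realType} {X : normedModType R[i]}.

Variable T : bop X X.

Lemma dual_comp_subproof (f : bop X R[i]^o) : f \o T \in @bop_pred R X R[i]^o.
Proof.
apply/bopE; split=> [a x y|x]; first by rewrite /= !linearP.
by apply: continuous_comp; exact: bop_continuous.
Qed.

Definition dual_comp (f : dual X) : dual X := Bop (dual_comp_subproof f).

Lemma adjoint_subproof : dual_comp \in @bop_pred R (dual X) (dual X).
Proof.
apply: (@bounded_bopP _ _ _ _ (opnorm T)) => [a f g||f].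
- exact: bop_ext.
- exact: opnorm_ge0.
- apply: opnorm_le => [|x]; first by rewrite mulr_ge0 ?opnorm_ge0.
  apply: (le_trans (ler_opnorm f _)).
  rewrite [leRHS]mulrAC mulrC; apply: (ler_wpM2r (opnorm_ge0 f)).
  exact: ler_opnorm.
Qed.

Definition adjoint : bop (dual X) (dual X) := Bop adjoint_subproof.

End Adjoint.

Record csubspace (R : realType) (X : normedModType R[i]) := CSubspace {
  csub_set :> set X;
  csub0 : csub_set 0;
  csub_lin : forall a x y, csub_set x -> csub_set y -> csub_set (a *: x + y);
  csub_closed : closed csub_set }.

Definition csub_pred (R : realType) (X : normedModType R[i])
  (M : csubspace X) : {pred X} := fun x => x \in csub_set M.

(* The closed subspace M as a normed space in its own right (a Banach space
   when X is one). *)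
Record csub (R : realType) (X : normedModType R[i]) (M : csubspace X) := CSub {
  csub_val :> X;
  csub_valP : csub_val \in csub_pred M }.

Section CsubNormed.
Context {R : realType} {X : normedModType R[i]}.
Variable M : csubspace X.

HB.instance Definition _ := [isSub of csub M for @csub_val R X M].
HB.instance Definition _ := [Choice of csub M by <:].

Lemma csubE x : x \in csub_pred M <-> csub_set M x.
Proof. by split=> [/set_mem|/mem_set]. Qed.

Lemma csub_submod_closed : submod_closed (csub_pred M).
Proof.
split; first by apply/csubE; exact: csub0.
by move=> a x y /csubE Mx /csubE My; apply/csubE; exact: csub_lin.
Qed.

HB.instance Definition _ :=
  GRing.isSubmodClosed.Build _ _ (csub_pred M) csub_submod_closed.
HB.instance Definition _ := [SubChoice_isSubLmodule of csub M by <:].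

Definition csub_norm (u : csub M) : R[i] := `|csub_val u|.

Lemma csub_normD u v : csub_norm (u + v) <= csub_norm u + csub_norm v.
Proof. exact: ler_normD. Qed.

Lemma csub_normZ a u : csub_norm (a *: u) = `|a| * csub_norm u.
Proof. exact: normrZ. Qed.

Lemma csub_norm_eq0 u : csub_norm u = 0 -> u = 0.
Proof. by move=> /normr0_eq0 u0; exact: val_inj. Qed.

HB.instance Definition _ :=
  Lmodule_isNormed.Build R[i] (csub M) csub_normD csub_normZ csub_norm_eq0.

End CsubNormed.

Section CsubComplete.
Context {R : realType} {X : completeNormedModType R[i]}.
Variable M : csubspace X.

Lemma csub_complete (F : set_system (csub M)) :
  ProperFilter F -> cauchy F -> cvg F.
Proof.
move=> FF /cauchy_ballP Fc.
have Gc : cauchy (@csub_val R X M @ F).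
  apply/cauchy_ballP => e e0; have := Fc e e0.
  rewrite /= => [[[A B] /= [FA FB] AB]].
  exists (@csub_val R X M @` A, @csub_val R X M @` B) => /=.
    split.
      by apply: (@filterS _ F _ A) => // u Au; exists u.
    by apply: (@filterS _ F _ B) => // u Bu; exists u.
  move=> [x y] /= [[u Au <-] [v Bv <-]].
  by have := AB (u, v) (conj Au Bv); rewrite /= -!ball_normE.
have /cvg_ex[l Fl] : cvg (@csub_val R X M @ F) by exact: cauchy_cvg.
have Ml : csub_set M l.
  apply: (@csub_closed _ _ M) => B /Fl FB.
  have [u Bu] := @filter_ex _ F _ _ FB.
  by exists (csub_val u); split=> //; apply/csubE; exact: csub_valP.
apply/cvg_ex; exists (CSub ((csubE M l).2 Ml)).
apply/cvgrPdist_lt => e e0.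
by move/cvgrPdist_lt : Fl => /(_ e e0).
Qed.

HB.instance Definition _ := Uniform_isComplete.Build (csub M) csub_complete.

End CsubComplete.

Section Restriction.
Context {R : realType} {X : normedModType R[i]}.
Variable T : bop X X.

Definition invariant (M : set X) := forall x, M x -> M (T x).

Variables (M : csubspace X) (TM : invariant M).

Definition restr_fun (u : csub M) : csub M :=
  CSub ((csubE M _).2 (TM ((csubE M _).1 (csub_valP u)))).

Lemma restr_subproof : restr_fun \in @bop_pred R (csub M) (csub M).
Proof.
apply: (@bounded_bopP _ _ _ _ (opnorm T)) => [a u v||u].
- by apply: val_inj; rewrite /= linearP.
- exact: opnorm_ge0.
- exact: ler_opnorm.
Qed.

Definition restr : bop (csub M) (csub M) := Bop restr_subproof.

Lemma restrE u : csub_val (restr u) = T (csub_val u).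
Proof. by []. Qed.

End Restriction.

Section OperatorClasses.
Context {R : realType}.
Implicit Types X V : normedModType R[i].

Definition invertible X (T : bop X X) := exists S, S * T = 1 /\ T * S = 1.

Definition spectrum X (T : bop X X) : set R[i]^o :=
  [set l | ~ invertible (T - l *: (1 : bop X X))].

(* Equal to (T - l)^-1 off the spectrum; the value 0 on it is a dummy. *)
Definition resolvent X (T : bop X X) (l : R[i]^o) : bop X X :=
  xget 0 [set S | S * (T - l *: (1 : bop X X)) = 1 /\
                  (T - l *: (1 : bop X X)) * S = 1].

(* Analyticity at a point is local expandability as a norm-convergent power
   series. *)
Definition analytic_at V (f : R[i]^o -> V) (z0 : R[i]^o) :=
  exists a : nat -> V, \forall z \near z0,
    series (fun n => (z - z0) ^+ n *: a n) @ \oo --> f z.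

(* f has a pole of order p at z0 when f(z) = (z - z0)^(-p) g(z) on a punctured
   neighbourhood of z0, with g analytic at z0 and g(z0) <> 0. *)
Definition pole V (f : R[i]^o -> V) (z0 : R[i]^o) :=
  exists (p : nat) (g : R[i]^o -> V), [/\ (0 < p)%N, analytic_at g z0,
    g z0 != 0 & \forall z \near z0^', f z = (z - z0) ^- p *: g z].

Definition meromorphic X (T : bop X X) := forall l : R[i]^o,
  l != 0 -> spectrum T l -> isolated (spectrum T) l /\ pole (resolvent T) l.

Definition bker X (T : bop X X) : set X := [set x | T x = 0].

Definition kato X (T : bop X X) :=
  closed (range T) /\ forall n, bker T `<=` range (T ^+ n).

Definition finite_dim X (A : set X) := exists (n : nat) (v : 'I_n -> X),
  A = range (fun c : 'I_n -> R[i] => \sum_(i < n) c i *: v i).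

(* The quotient of X by the subspace A is finite-dimensional. *)
Definition finite_codim X (A : set X) := exists (n : nat) (v : 'I_n -> X),
  forall x, exists (c : 'I_n -> R[i]), A (x - \sum_(i < n) c i *: v i).

Definition fredholm X (T : bop X X) :=
  finite_dim (bker T) /\ finite_codim (range T).

Definition finite_ascent X (T : bop X X) :=
  exists n, bker (T ^+ n) = bker (T ^+ n.+1).

Definition finite_descent X (T : bop X X) :=
  exists n, range (T ^+ n) = range (T ^+ n.+1).

Definition browder X (T : bop X X) :=
  [/\ fredholm T, finite_ascent T & finite_descent T].

Lemma range_bop0 X (T : bop X X) : range T 0.
Proof. by exists 0; rewrite ?linear0. Qed.

Lemma range_bop_lin X (T : bop X X) a x y :
  range T x -> range T y -> range T (a *: x + y).
Proof. by move=> [u _ <-] [v _ <-]; exists (a *: u + v); rewrite ?linearP. Qed.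

Definition range_csub X (T : bop X X) (cT : closed (range T)) : csubspace X :=
  CSubspace (range_bop0 T) (@range_bop_lin X T) cT.

Lemma range_invariant X (T : bop X X) n : invariant T (range (T ^+ n)).
Proof. by move=> _ [x _ <-]; exists (T x); rewrite // -!bopME -exprSr exprS. Qed.

Definition b_browder X (T : bop X X) :=
  exists (n : nat) (cTn : closed (range (T ^+ n))),
    browder (@restr R X T (range_csub cTn) (@range_invariant X T n)).

Definition b_browder_spectrum X (T : bop X X) : set R[i]^o :=
  [set l | ~ b_browder (T - l *: (1 : bop X X))].

Definition svep X (T : bop X X) (l0 : R[i]^o) :=
  forall (r : R[i]) (f : R[i]^o -> X), 0 < r ->
    (forall l, ball l0 r l -> analytic_at f l) ->
    (forall l, ball l0 r l -> (T - l *: (1 : bop X X)) (f l) = 0) ->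
    forall l, ball l0 r l -> f l = 0.

(* Elements of Red T are the pairs (M, N) in Red(T). *)
Record Red X (T : bop X X) := MkRed {
  redM : csubspace X;
  redN : csubspace X;
  redM_inv : invariant T redM;
  redN_inv : invariant T redN;
  red_cap : redM `&` redN = [set 0];
  red_sum : forall x, exists y z, [/\ csub_set redM y, csub_set redN z & x = y + z] }.

Arguments redM_inv {X T} r x _.
Arguments redN_inv {X T} r x _.

Definition restrM X (T : bop X X) (d : Red T) := restr (redM_inv d).
Definition restrN X (T : bop X X) (d : Red T) := restr (redN_inv d).

Definition gen_kato_meromorphic X (T : bop X X) :=
  exists d : Red T, kato (restrM d) /\ meromorphic (restrN d).

Definition gen_drazin_meromorphic_invertible X (T : bop X X) :=
  exists S : bop X X,
    [/\ T * S = S * T, S * T * S = S & meromorphic (T * S * T - T)].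

Definition projection X (P : bop X X) := P * P = P.

Definition meromorphic_quasi_polar X (T : bop X X) :=
  exists Q : bop X X, [/\ projection Q, T * Q = Q * T,
    meromorphic (T * (1 - Q)) & exists U V : bop X X, Q = U * T /\ Q = T * V].

End OperatorClasses.

(* Main.v *)
Require Import Defs.
From HB Require Import structures.
From mathcomp Require Import all_boot all_order all_algebra.
From mathcomp Require Import ring lra.
From mathcomp Require Import complex.
From mathcomp Require Import all_classical all_reals all_analysis.

(* Everything reduces to an algebraic notion: [drazin A] (A^p = A^(p+1) B for
   some B commuting with A).  For bounded operators on a Banach space it is
   equivalent to being B-Browder, and an operator T is meromorphic iff T - l is
   Drazin invertible for every l != 0: the coefficients of the Laurent expansion
   of the resolvent at a pole satisfy A a_n = a_(n-1) + [n = p], which forces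
   A^p = A^(p+1) a_p, and conversely a Drazin inverse provides the expansion.
   Drazin invertibility passes to and from direct summands, so the conditions
   without "Kato" are compared summand by summand.

   If T_M is Kato, a vector of its kernel starts a backward orbit
   T x_(k+1) = x_k with geometric growth, and f(l) = sum l^k x_k solves
   (T - l) f(l) = 0; the SVEP of T at 0 makes T_M injective.  If T_M is not onto,
   the Hahn-Banach theorem yields such an orbit for the adjoint, against the SVEP
   of T'.  Conversely the SVEP of both operators at 0 follows by the identity
   theorem as soon as T - l is invertible for arbitrarily small l != 0, and
   punctured neighbourhoods of the B-Browder points of T consist of points of
   the resolvent set. *)

Set Implicit Arguments.
Unset Strict Implicit.
Unset Printing Implicit Defensive.
Import Order.TTheory GRing.Theory Num.Theory.
Import numFieldNormedType.Exports.
Local Open Scope classical_set_scope.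
Local Open Scope complex_scope.
Local Open Scope ring_scope.

(** * Real-valued norm *)

(** The delicate passage is from a B-Browder summand to an invertible one: its nilpotent part has to
    move into the meromorphic summand. This is not done on subspaces. The Drazin inverse of T_M,
    extended by zero, is a generalized Drazin-meromorphic inverse [S] of [T], and the idempotent
    [T * S] then produces a new decomposition. The projection [P] of (vi) and (vii) is the one onto
    [N] along [M]; adding it turns T_N into T_N + 1, which is Drazin invertible because -1 is a
    nonzero shift. No contour integrals occur: from a pole to a Drazin inverse, uniqueness of power
    series coefficients suffices, and the way back uses an explicit series. Operators prescribed
    separately on two spanning ranges, such as the projections of a direct sum or a Drazin inverse,
    are bounded by a single factorization lemma, [bop_factor], drawn from the open mapping theorem.
    The SVEP is available for [T] and its adjoint only, so the orbits found for T_M are carried to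
    the whole space by an injection and to the whole dual by composition with a projection. *)

Section RealNorm.
Context {R : realType}.

(** Norms take values in the partially ordered field [R[i]]. Their real parts carry the same
    information and live in [R], where suprema exist and linear arithmetic applies. *)
Definition rn (V : normedZmodType R[i]) (x : V) : R := complex.Re `|x|.

Section Zmod.
Variable V : normedZmodType R[i].
Implicit Types x y : V.

Lemma rnE x : `|x| = (rn x)%:C.
Proof.
by rewrite /rn; have := normr_ge0 x; case: `|x| => a b; rewrite lecE /= => /andP[/eqP ->].
Qed.

Lemma rn_ge0 x : 0 <= rn x.
Proof. by rewrite -lecR -rnE normr_ge0. Qed.

Lemma rn0 : rn (0 : V) = 0.
Proof. by rewrite /rn normr0. Qed.

Lemma rnN x : rn (- x) = rn x.
Proof. by rewrite /rn normrN. Qed.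

Lemma rnB x y : rn (x - y) = rn (y - x).
Proof. by rewrite /rn distrC. Qed.

Lemma ler_rnD x y : rn (x + y) <= rn x + rn y.
Proof. by rewrite -lecR rmorphD /= -!rnE ler_normD. Qed.

Lemma ler_rnB x y : rn (x - y) <= rn x + rn y.
Proof. by rewrite -(rnN y) ler_rnD. Qed.

Lemma ler_rnBD (z x y : V) : rn (x - y) <= rn (x - z) + rn (z - y).
Proof. by rewrite (le_trans _ (ler_rnD _ _)) // addrA subrK. Qed.

Lemma rn_eq0 x : rn x <= 0 -> x = 0.
Proof. by move=> h; apply/eqP; rewrite -normr_le0 rnE lecR. Qed.

Lemma ler_rn_sum n (F : nat -> V) :
  rn (\sum_(i < n) F i) <= \sum_(i < n) rn (F i).
Proof.
elim: n => [|n IH]; first by rewrite !big_ord0 rn0.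
by rewrite !big_ord_recr /= (le_trans (ler_rnD _ _)) // lerD2r.
Qed.
End Zmod.

Lemma rnZ (V : normedModType R[i]) (a : R[i]) (x : V) : rn (a *: x) = rn a * rn x.
Proof.
apply/eqP; rewrite -(inj_eq (@complexI R)).
by rewrite rmorphM /= -!rnE normrZ.
Qed.

Lemma rnM (a b : R[i]) : rn (a * b) = rn a * rn b.
Proof. exact: (@rnZ R[i]^o). Qed.

Lemma rn1 : rn (1 : R[i]) = 1.
Proof. by rewrite /rn normr1. Qed.

Lemma rnX (a : R[i]) n : rn (a ^+ n) = rn a ^+ n.
Proof. by elim: n => [|n IH]; rewrite ?expr0 ?rn1 // !exprS rnM IH. Qed.

Lemma rnC (a : R) : rn a%:C = `|a|.
Proof. by rewrite /rn normc_def /= expr0n /= addr0 sqrtr_sqr. Qed.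

Lemma rn_eq0P (V : normedZmodType R[i]) (x : V) : (rn x == 0) = (x == 0).
Proof.
by apply/eqP/eqP => [h|->]; [apply: rn_eq0; rewrite h|rewrite rn0].
Qed.

Lemma rn_gt0 (V : normedZmodType R[i]) (x : V) : (0 < rn x) = (x != 0).
Proof. by rewrite lt_neqAle rn_ge0 andbT eq_sym rn_eq0P. Qed.

Lemma rnV (a : R[i]) : rn a^-1 = (rn a)^-1.
Proof.
have [->|a0] := eqVneq a 0; first by rewrite invr0 rn0 invr0.
have ra : rn a != 0 by rewrite rn_eq0P.
by apply: (mulfI ra); rewrite -rnM !mulfV // rn1.
Qed.

Lemma gt0_complexP (e : R[i]) : 0 < e -> exists2 d : R, 0 < d & e = d%:C.
Proof.
case: e => a b; rewrite ltcE /= => /andP[/eqP -> a0].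
by exists a.
Qed.

Section Topo.
Variable V : normedModType R[i].
Implicit Types x y : V.

Lemma nbhs_rnP x (A : set V) :
  nbhs x A <-> exists2 e : R, 0 < e & forall y, rn (x - y) < e -> A y.
Proof.
split=> [/nbhs_ballP[e e0 eA]|[e e0 eA]].
  have [d d0 ed] := gt0_complexP e0; exists d => // y xy; apply: eA.
  by rewrite -ball_normE /= rnE ed ltcR.
apply/nbhs_ballP; exists e%:C => /=; first by rewrite ltcR.
by move=> y; rewrite -ball_normE /= rnE ltcR; exact: eA.
Qed.

Lemma cvg_rnP (u : nat -> V) x :
  u @ \oo --> x <-> forall e : R, 0 < e ->
    exists N, forall n, (N <= n)%N -> rn (x - u n) < e.
Proof.
split=> [ux e e0|ux A /nbhs_rnP[e e0 eA]].
  have /ux [N _ h] : nbhs x [set y | rn (x - y) < e] by apply/nbhs_rnP; exists e.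
  by exists N => n Nn; exact: h.
have [N h] := ux e e0; exists N => // n /= Nn; exact/eA/h.
Qed.

Lemma closed_rnP (A : set V) : closed A <->
  forall x, (forall e : R, 0 < e -> exists2 y, A y & rn (x - y) < e) -> A x.
Proof.
split=> [cA x h|h x cx].
  apply: cA => B /nbhs_rnP[e e0 eB]; have [y Ay xy] := h e e0.
  by exists y; split=> //; exact: eB.
apply: h => e e0; have [y [Ay xy]] : A `&` [set y | rn (x - y) < e] !=set0.
  by apply: cx; apply/nbhs_rnP; exists e.
by exists y.
Qed.

Lemma cvg_rn_unique (u : nat -> V) x y :
  u @ \oo --> x -> u @ \oo --> y -> x = y.
Proof. by move=> ux uy; apply: (cvg_unique _ ux uy). Qed.

Lemma cvg_rn_le (u : nat -> V) x y (M : R) N :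
  u @ \oo --> x -> (forall n, (N <= n)%N -> rn (y - u n) <= M) -> rn (y - x) <= M.
Proof.
move=> /cvg_rnP ux h; apply/ler_addgt0Pr => e e0.
have [N' h'] := ux e e0; set n := maxn N N'.
have h1 := h n (leq_maxl _ _); have h2 := h' n (leq_maxr _ _).
have := ler_rnBD (u n) y x; have := rnB x (u n); lra.
Qed.
End Topo.

Lemma cvg_bop (V W : normedModType R[i]) (T : bop V W) (u : nat -> V) x :
  u @ \oo --> x -> (fun n => T (u n)) @ \oo --> T x.
Proof. by move=> ux; apply: continuous_cvg => //; exact: bop_continuous. Qed.

Lemma rn_bop (V W : normedModType R[i]) (T : bop V W) x : rn (T x) <= rn T * rn x.
Proof. by rewrite -lecR rmorphM /= -!rnE ler_opnorm. Qed.

Lemma rn_bop_le (V W : normedModType R[i]) (T : bop V W) (k : R) :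
  0 <= k -> (forall x, rn (T x) <= k * rn x) -> rn T <= k.
Proof.
move=> k0 h; rewrite -lecR -rnE; apply: opnorm_le => [|x]; first by rewrite lecR.
by rewrite !rnE -rmorphM lecR.
Qed.

Lemma bop_rnP (V W : normedModType R[i]) (f : V -> W) (k : R) :
  linear f -> 0 <= k -> (forall x, rn (f x) <= k * rn x) ->
  exists T : bop V W, forall x, T x = f x.
Proof.
move=> lf k0 h.
have fP : f \in @bop_pred R V W.
  apply: (@bounded_bopP _ _ _ _ k%:C) => // [|x]; first by rewrite lecR.
  by rewrite !rnE -rmorphM lecR.
by exists (Bop fP).
Qed.

Lemma rn_comp (V : normedModType R[i]) (T S : bop V V) : rn (T * S) <= rn T * rn S.
Proof.
apply: rn_bop_le => [|x]; first by rewrite mulr_ge0 ?rn_ge0.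
rewrite bopME (le_trans (rn_bop _ _)) // -mulrA ler_wpM2l ?rn_ge0 //.
exact: rn_bop.
Qed.

Lemma geom_small (c q e : R) : 0 <= q -> q < 1 -> 0 < e ->
  exists N, forall n, (N <= n)%N -> c * q ^+ n < e.
Proof.
move=> q0 q1 e0; have q1' : `|q| < 1 by rewrite ger0_norm.
have /cvgrPdist_lt /(_ (e / (1 + `|c|))) := cvg_geometric 1 q1'.
have c1 : 0 < 1 + `|c| by have := normr_ge0 c; lra.
move=> /(_ (divr_gt0 e0 c1)) [N _ h]; exists N => n /h /=.
rewrite sub0r normrN mul1r ger0_norm ?exprn_ge0 // ltr_pdivlMr // => hn.
have p0 := exprn_ge0 n q0; have := ler_norm c; nra.
Qed.

Section Complete.
Variable V : completeNormedModType R[i].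

Lemma cauchy_rn_cvg (u : nat -> V) :
  (forall e : R, 0 < e -> exists N, forall m, (N <= m)%N -> rn (u N - u m) < e) ->
  exists x : V, u @ \oo --> x.
Proof.
move=> h; have : cvg (u @ \oo); last by move=> /cvg_ex.
apply: cauchy_cvg.
apply: cauchy_exP => e e0; have [d d0 ed] := gt0_complexP e0.
have [N hN] := h d d0; exists (u N); exists N => // m /= /hN.
by rewrite -ball_normE /= rnE ed ltcR.
Qed.

End Complete.

Lemma series_rec (V : normedModType R[i]) (u : nat -> V) n :
  series u n.+1 = series u n + u n.
Proof. by rewrite /series /= big_nat_recr. Qed.

Lemma series_geom_dist (V : normedModType R[i]) (u : nat -> V) (c q : R) N :
  0 <= q -> q < 1 ->
  (forall n, (N <= n)%N -> rn (u n) <= c * q ^+ n) ->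
  forall m, (N <= m)%N -> rn (series u N - series u m) <= c * q ^+ N / (1 - q).
Proof.
move=> q0 q1 h m Nm; have q1' : 0 < 1 - q by lra.
(* This sharper bound telescopes in the induction on [m]; the term dropped afterwards is nonnegative
   because it dominates a norm. *)
suff : rn (series u N - series u m) <= c * (q ^+ N - q ^+ m) / (1 - q).
  move=> /le_trans; apply; rewrite ler_pM2r ?invr_gt0 //.
  have : 0 <= c * q ^+ m by rewrite (le_trans (rn_ge0 _) (h m Nm)).
  lra.
elim: m Nm => [|m IH]; first by rewrite leqn0 => /eqP ->; rewrite !subrr rn0 mulr0 mul0r.
rewrite leq_eqVlt => /orP[/eqP ->|]; first by rewrite !subrr rn0 mulr0 mul0r.
rewrite ltnS => Nm; rewrite series_rec opprD addrA (le_trans (ler_rnB _ _)) //.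
rewrite (le_trans (lerD (IH Nm) (h m Nm))) //.
rewrite -[X in _ + X](mulfK (lt0r_neq0 q1')) -mulrDl ler_pM2r ?invr_gt0 //.
by rewrite exprS; lra.
Qed.

Lemma series_geom_cvg (V : completeNormedModType R[i]) (u : nat -> V) (c q : R) :
  0 <= q -> q < 1 -> (forall n, rn (u n) <= c * q ^+ n) ->
  exists x : V, series u @ \oo --> x.
Proof.
move=> q0 q1 h; have q1' : 0 < 1 - q by lra.
apply: cauchy_rn_cvg => e e0.
have [N hN] := geom_small (c / (1 - q)) q0 q1 e0; exists N => m Nm.
apply: le_lt_trans (hN N (leqnn N)).
by rewrite mulrAC; apply: series_geom_dist.
Qed.

Lemma series_geom_tail (V : normedModType R[i]) (u : nat -> V) (c q : R) N x :
  0 <= q -> q < 1 -> (forall n, (N <= n)%N -> rn (u n) <= c * q ^+ n) ->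
  series u @ \oo --> x -> rn (series u N - x) <= c * q ^+ N / (1 - q).
Proof.
by move=> q0 q1 h ux; apply: (cvg_rn_le (N := N) ux) => n; apply: series_geom_dist.
Qed.

End RealNorm.

(** * Open mapping *)

Section BopComplete.
Context {R : realType} {X : normedModType R[i]}.

(** Completeness of [Y] is an explicit hypothesis so that the lemma also covers functionals, once
    the scalar field [R[i]^o] is shown to be complete. The limit is taken pointwise; the Cauchy
    estimate, uniform on vectors, makes it bounded and a limit in norm. *)
Lemma bop_complete_of (Y : normedModType R[i])
    (Y_complete : forall G : set_system Y, ProperFilter G -> cauchy G -> cvg G)
    (F : set_system (bop X Y)) :
  ProperFilter F -> cauchy F -> cvg F.
Proof.
move=> FF Fc.
have {}Fc e : 0 < e -> exists2 A : set (bop X Y), F A &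
    forall T S, A T -> A S -> rn (T - S) < e.
  move=> e0; have e0' : 0 < e%:C :> R[i] by rewrite ltcR.
  move/cauchy_ballP : (Fc) => /(_ e%:C e0')[[A B] /= [FA FB] AB].
  exists (A `&` B) => [|T S [AT _] [_ BS]]; first exact: filterI.
  by have := AB (T, S) (conj AT BS); rewrite /= -ball_normE /= rnE ltcR.
have ex_lim x : exists l : Y, (fun T : bop X Y => T x) @ F --> l.
  have : cvg ((fun T : bop X Y => T x) @ F); last by move=> /cvg_ex.
  apply: Y_complete; apply: cauchy_exP => e e0.
  have [d d0 ->] := gt0_complexP e0.
  have x1 : 0 < rn x + 1 by have := rn_ge0 x; lra.
  have [A FA Ad] := Fc _ (divr_gt0 d0 x1).
  have [T0 AT0] := @filter_ex _ F _ _ FA.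
  exists (T0 x); apply: (@filterS _ F _ A) => //= T AT.
  rewrite -ball_normE /= rnE ltcR -bopNE -bopDE (le_lt_trans (rn_bop _ _)) //.
  have := Ad _ _ AT0 AT; rewrite ltr_pdivlMr // => h.
  have := rn_ge0 x; have := rn_ge0 (T0 - T); nra.
have [L FL] := choice ex_lim.
have L_approx e x (l : Y) (A : set (bop X Y)) : F A ->
    (forall T, A T -> rn (l - T x) <= e) -> rn (l - L x) <= e.
  move=> FA Ae; apply/ler_addgt0Pr => d d0.
  have /FL FB : nbhs (L x) [set y | rn (L x - y) < d] by apply/nbhs_rnP; exists d.
  have [T [AT BT]] := @filter_ex _ F _ _ (@filterI _ F _ A _ FA FB).
  have := ler_rnBD (T x) l (L x); have := Ae T AT.
  by move: BT; rewrite /=; have := rnB (L x) (T x); lra.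
have L_close e : 0 < e -> exists2 A : set (bop X Y), F A &
    forall T, A T -> forall x, rn (T x - L x) <= e * rn x.
  move=> e0; have [A FA Ad] := Fc e e0; exists A => // T AT x.
  apply: (L_approx _ _ _ A) => // S AS; rewrite -bopNE -bopDE.
  by rewrite (le_trans (rn_bop _ _)) // ler_wpM2r ?rn_ge0 // ltW ?Ad.
have lL : linear L.
  move=> a x y; apply: (cvg_unique _ (FL (a *: x + y))) => //=.
  have -> : (fun T : bop X Y => T (a *: x + y)) = (fun T => a *: T x + T y).
    by apply/funext => T; rewrite linearP.
  by apply: cvgD; [apply: cvgZl_tmp|]; exact: FL.
have [A FA Ad] := L_close 1 ltr01.
have [T0 AT0] := @filter_ex _ F _ _ FA.
have [Lb LbE] : exists Lb : bop X Y, forall x, Lb x = L x.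
  apply: (bop_rnP (k := rn T0 + 1)) => // [|x]; first by have := rn_ge0 T0; lra.
  have := Ad _ AT0 x; have := ler_rnBD (T0 x) (L x) 0; rewrite !subr0 rnB.
  have := rn_bop T0 x; lra.
apply/cvg_ex; exists Lb => B /nbhs_rnP[e e0 eB].
have e2 : 0 < e / 2 by lra.
have [A' FA' A'e] := L_close _ e2; apply: (@filterS _ F _ A') => // T AT.
apply: eB; rewrite rnB; apply: (@le_lt_trans _ _ (e / 2)); last by lra.
apply: rn_bop_le => [|x]; first by lra.
by rewrite bopDE bopNE LbE A'e.
Qed.

HB.instance Definition _ (Y : completeNormedModType R[i]) :=
  Uniform_isComplete.Build (bop X Y) (bop_complete_of (@cauchy_cvg Y)).

End BopComplete.

Section OpenMapping.
Context {R : realType}.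

(** Baire category: if no [F n] were dense in a ball, every ball would contain a smaller one away
    from [F n], and the centres of such nested balls would converge to a point in no [F n]. *)
Lemma baire_rn (V : completeNormedModType R[i]) (F : nat -> set V) :
  (forall x, exists n, F n x) ->
  exists n x (r : R), 0 < r /\ forall y, rn (x - y) < r ->
    forall e, 0 < e -> exists2 z, F n z & rn (y - z) < e.
Proof.
move=> cov; apply: contrapT => H.
have step (q : nat * (V * R)) : exists q' : V * R, 0 < q.2.2 ->
    [/\ 0 < q'.2, q'.2 <= q.2.2 / 2, rn (q.2.1 - q'.1) <= q.2.2 - q'.2 &
        forall z, F q.1 z -> q'.2 < rn (q'.1 - z)].
  case: q => n [x r] /=; have [r0|] := ltrP 0 r; last by exists (x, r) => /=.
  have [y yr [e e0 ey]] : exists2 y, rn (x - y) < r &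
      exists2 e, 0 < e & forall z, F n z -> e <= rn (y - z).
    apply: contrapT => H'; apply: H; exists n, x, r; split=> // y yr e e0.
    apply: contrapT => H''; apply: H'; exists y => //; exists e => // z Fz.
    by rewrite leNgt; apply/negP => yz; apply: H''; exists z.
  (* The three bounds keep the new ball strictly away from [F n], inside the old ball, and of at
     most half its radius. *)
  exists (y, Num.min (e / 2) (Num.min (r - rn (x - y)) (r / 2))) => _ /=.
  split.
  - by rewrite !lt_min; apply/and3P; split; lra.
  - by rewrite !ge_min lexx !orbT.
  - have : Num.min (e / 2) (Num.min (r - rn (x - y)) (r / 2)) <= r - rn (x - y).
      by rewrite !ge_min lexx !orbT.
    lra.
  - move=> z /ey; apply: lt_le_trans; rewrite gt_min; apply/orP; left; lra.
have [f fP] := choice step.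
pose p := fix p n : V * R := if n is m.+1 then f (m, p m) else (0, 1).
have p_gt0 n : 0 < (p n).2.
  by elim: n => [|n IH] //=; have [] := fP (n, p n) IH.
have pP n := fP (n, p n) (p_gt0 n).
have p_half n : (p n).2 <= 1 * 2^-1 ^+ n.
  elim: n => [|n IH]; first by rewrite expr0 mulr1.
  by have [_ h _ _] := pP n; rewrite exprS /=; move: h => /=; lra.
have p_dist n m : (n <= m)%N -> rn ((p n).1 - (p m).1) <= (p n).2 - (p m).2.
  elim: m => [|m IH]; first by rewrite leqn0 => /eqP ->; rewrite !subrr rn0.
  rewrite leq_eqVlt => /orP[/eqP ->|]; first by rewrite !subrr rn0.
  rewrite ltnS => /IH h; have [_ _ h' _] := pP m.
  by have := ler_rnBD (p m).1 (p n).1 (p m.+1).1; move: h' => /=; lra.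
have [x px] : exists x : V, (fun n => (p n).1) @ \oo --> x.
  apply: cauchy_rn_cvg => e e0.
  have [|||N hN] := @geom_small R 1 (2^-1) e; [lra|lra|by []|].
  exists N => m Nm; apply: le_lt_trans (hN N (leqnn N)).
  by have := p_dist N m Nm; have := p_half N; have := p_gt0 m; lra.
have [n Fx] := cov x.
have [_ _ _ h] := pP n; have := h x Fx; rewrite ltNge => /negP; apply.
apply: (cvg_rn_le (N := n.+1) px) => m nm.
by have := p_dist n.+1 m nm; have := p_gt0 m; rewrite /=; lra.
Qed.

Lemma rn_half : rn (2^-1 : R[i]) = 2^-1.
Proof. by rewrite rnV (_ : 2 = 2%:C) ?rnC ?gtr0_norm // rmorph_nat. Qed.

(* [A] is the image of a unit ball in the applications: closedness is replaced
   by stability under infinite convex combinations. *)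
Lemma ideally_convex_ball (V : completeNormedModType R[i]) (A : set V) :
  (forall a b, A a -> A b -> A (2^-1 *: (a - b))) ->
  (forall x, exists n : nat, A (n.+1%:R^-1 *: x)) ->
  (forall (a : nat -> V) y, (forall n, A (a n)) ->
     series (fun n => 2^-1 ^+ n.+1 *: a n) @ \oo --> y -> A y) ->
  exists2 d : R, 0 < d & forall y, rn y < d -> A y.
Proof.
move=> Amid Aabs Aconv.
have [n [c [r [r0 cr]]]] := baire_rn Aabs.
have rn2 := rn_half.
have rnn : rn (n.+1%:R^-1 : R[i]) = n.+1%:R^-1.
  by rewrite rnV -(rmorph_nat (real_complex R)) rnC ger0_norm.
have n0 : 0 < n.+1%:R :> R by rewrite ltr0n.
pose d := r / n.+1%:R.
have d0 : 0 < d by rewrite divr_gt0.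
(* Recentring at 0: [x] is half the difference of [c + x] and [c - x], both in the ball around [c],
   and [A] is stable under half differences. *)
have dense_ball w : rn w < d -> forall e, 0 < e -> exists2 a, A a & rn (w - a) < e.
  move=> wd e e0; set x := n.+1%:R *: w.
  have xw : w = n.+1%:R^-1 *: x by rewrite scalerA mulVf ?pnatr_eq0 // scale1r.
  have xr : rn x < r.
    by rewrite /x rnZ -(rmorph_nat (real_complex R)) rnC ger0_norm // mulrC -ltr_pdivlMr.
  have [|a Aa ae] := cr (c + x) _ e e0; first by rewrite opprD addNKr rnN.
  have [|b Ab be] := cr (c - x) _ e e0; first by rewrite opprB addrCA subrr addr0.
  exists (2^-1 *: (n.+1%:R^-1 *: a - n.+1%:R^-1 *: b)); first exact: Amid.
  have -> : w - 2^-1 *: (n.+1%:R^-1 *: a - n.+1%:R^-1 *: b) =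
      n.+1%:R^-1 *: (2^-1 *: ((c + x - a) - (c - x - b))).
    have -> : (c + x - a) - (c - x - b) = x *+ 2 - (a - b).
      rewrite !opprB mulr2n addrC (addrC c) -!addrA.
      by rewrite (addrCA (- c)) addKr (addrCA b) (addrCA b).
    rewrite [2^-1 *: (_ *+ 2 - _)]scalerBr -[x *+ 2]scaler_nat scalerA mulVf ?pnatr_eq0 //.
    by rewrite scale1r [RHS]scalerBr -xw -scalerBr !scalerA mulrC.
  rewrite rnZ rnn.
  rewrite rnZ rn2 ltr_pdivrMl //; have := ler_rnB (c + x - a) (c - x - b).
  have : 1 <= n.+1%:R :> R by rewrite ler1n.
  nra.
have /choice[g gP] w : exists a, rn w < d -> A a /\ rn (w - a) < d / 2.
  have [wd|] := ltrP (rn w) d; last by exists 0.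
  have [|a Aa wa] := dense_ball w wd (d / 2); first by lra.
  by exists a.
exists (d / 2) => [|y yd]; first by lra.
(* [w n] is the part of [y] not yet represented, magnified by 2 to the power [n.+1]. Doubling undoes
   the halved error of [g]; the initial factor 2 matches the first weight of the series and is why
   the final radius is [d / 2]. *)
pose w := fix w n : V := if n is m.+1 then 2 *: (w m - g (w m)) else 2 *: y.
have rn22 : rn (2 : R[i]) = 2 by rewrite -[2](rmorph_nat (real_complex R)) rnC gtr0_norm.
have wd k : rn (w k) < d.
  elim: k => [|k IH] /=; rewrite rnZ rn22; first by lra.
  by have [_] := gP _ IH; lra.
apply: (Aconv (fun k => g (w k))) => [k|]; first by have [] := gP _ (wd k).
have sE k : y - series (fun n => 2^-1 ^+ n.+1 *: g (w n)) k = 2^-1 ^+ k.+1 *: w k.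
  elim: k => [|k IH].
    by rewrite /series /= big_geq // subr0 expr1 scalerA mulVf ?pnatr_eq0 // scale1r.
  rewrite series_rec opprD addrA IH -scalerBr /= [in RHS]exprSr -scalerA.
  by rewrite (scalerA 2^-1) mulVf ?pnatr_eq0 // scale1r.
apply/cvg_rnP => e e0.
have [|||N hN] := @geom_small R d (2^-1) e; [lra|lra|by []|].
exists N => k Nk; apply: le_lt_trans (hN k Nk); rewrite sE rnZ rnX rn2 exprS.
have := wd k; have := rn_ge0 (w k); have : 0 <= 2^-1 ^+ k :> R by rewrite exprn_ge0.
nra.
Qed.

(* The open mapping theorem for [F1 + F2] on [V1 * V2], stated without products
   of Banach spaces. *)
Lemma open_mapping2 (V1 V2 W : completeNormedModType R[i])
    (F1 : bop V1 W) (F2 : bop V2 W) :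
  (forall x, exists v1 v2, x = F1 v1 + F2 v2) ->
  exists2 C : R, 0 <= C & forall x, exists v1 v2,
    [/\ x = F1 v1 + F2 v2, rn v1 <= C * rn x & rn v2 <= C * rn x].
Proof.
move=> onto.
have rn2 := rn_half.
pose A := [set x | exists v1 v2, [/\ x = F1 v1 + F2 v2, rn v1 <= 1 & rn v2 <= 1]].
have [|||d d0 dA] := @ideally_convex_ball W A.
- move=> a b [v1 [v2 [-> h1 h2]]] [w1 [w2 [-> k1 k2]]].
  exists (2^-1 *: (v1 - w1)), (2^-1 *: (v2 - w2)); rewrite !rnZ rn2; split.
  + rewrite !linearZ /= -scalerDr; congr (_ *: _).
    by rewrite !linearB /= opprD addrACA.
  + by have := ler_rnB v1 w1; lra.
  + by have := ler_rnB v2 w2; lra.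
- move=> x; have [v1 [v2 ->]] := onto x.
  pose n := Num.truncn (rn v1 + rn v2).
  have nP : rn v1 + rn v2 < n.+1%:R by rewrite /n truncnS_gt.
  have n0 : 0 < n.+1%:R :> R by rewrite ltr0n.
  exists n, (n.+1%:R^-1 *: v1), (n.+1%:R^-1 *: v2).
  rewrite !rnZ rnV -(rmorph_nat (real_complex R)) rnC gtr0_norm // !ler_pdivrMl // mulr1.
  have := rn_ge0 v1; have := rn_ge0 v2; split; [|lra|lra].
  by rewrite !linearZ /= -scalerDr.
- move=> a y Aa ay; have [v1 /choice[v2 vP]] := choice Aa.
  have conv (V : completeNormedModType R[i]) (v : nat -> V) : (forall n, rn (v n) <= 1) ->
      exists2 x : V, series (fun n => 2^-1 ^+ n.+1 *: v n) @ \oo --> x & rn x <= 1.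
    move=> v1'; have h n : rn (2^-1 ^+ n.+1 *: v n) <= 2^-1 * 2^-1 ^+ n.
      by rewrite rnZ rnX rn2 -exprS ler_piMr // exprn_ge0.
    have [q0 q1] : 0 <= 2^-1 :> R /\ 2^-1 < 1 :> R by split; lra.
    have [x vx] := series_geom_cvg q0 q1 h; exists x => //.
    have := series_geom_tail (N := 0) q0 q1 (fun n _ => h n) vx.
    rewrite {1}/series /= big_geq // sub0r rnN expr0 mulr1.
    by rewrite (_ : 1 - 2^-1 = 2^-1 :> R) ?mulfV //; lra.
  have [n|x1 sx1 x1b] := conv _ v1; first by have [] := vP n.
  have [n|x2 sx2 x2b] := conv _ v2; first by have [] := vP n.
  exists x1, x2; split=> //; apply: (cvg_rn_unique ay).
  rewrite (_ : series _ = fun n => F1 (series (fun n => 2^-1 ^+ n.+1 *: v1 n) n) +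
    F2 (series (fun n => 2^-1 ^+ n.+1 *: v2 n) n)); last first.
    apply/funext => n; elim: n => [|n IH].
      by rewrite /series /= !big_geq // !linear0 addr0.
    rewrite !series_rec IH !linearD /= !linearZ /= addrACA -scalerDr.
    by have [-> _ _] := vP n.
  by apply: cvgD; apply: cvg_bop.
exists (2 / d) => [|x]; first by rewrite divr_ge0 // ltW.
have [->|x0] := eqVneq x 0.
  by exists 0, 0; rewrite !linear0 addr0 !rn0 mulr0.
have rx : 0 < rn x by rewrite rn_gt0.
(* This factor brings [x] to norm [d / 2], inside the ball contained in [A]; hence the constant
   [2 / d]. *)
pose t := d / (2 * rn x).
have t0 : 0 < t by rewrite divr_gt0 // mulr_gt0.
have [v1 [v2 [xv h1 h2]]] : A (t%:C *: x).
  apply: dA; rewrite rnZ rnC gtr0_norm // /t.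
  rewrite (_ : d / (2 * rn x) * rn x = d / 2); first by lra.
  by field; rewrite lt0r_neq0.
have tc : t%:C != 0 by rewrite (inj_eq (@complexI R)) lt0r_neq0.
have bound (V : completeNormedModType R[i]) (v : V) : rn v <= 1 ->
    rn (t%:C^-1 *: v) <= 2 / d * rn x.
  rewrite rnZ rnV rnC gtr0_norm // /t => v1'.
  rewrite (_ : (d / (2 * rn x))^-1 = 2 / d * rn x); last first.
    by field; rewrite !lt0r_neq0.
  by rewrite ler_piMr // mulr_ge0 ?ltW // divr_gt0.
exists (t%:C^-1 *: v1), (t%:C^-1 *: v2); split; [|exact: bound|exact: bound].
by rewrite !linearZ /= -scalerDr -xv scalerA mulVf // scale1r.
Qed.

(** A map on the pair of spaces that kills the kernel of the surjection [F1 + F2] factors through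
    it; the factor is bounded because preimages can be chosen with norms controlled by
    [open_mapping2]. *)
Lemma bop_factor (V1 V2 W : completeNormedModType R[i]) (Z : normedModType R[i])
    (F1 : bop V1 W) (F2 : bop V2 W) (G1 : bop V1 Z) (G2 : bop V2 Z) :
  (forall x, exists v1 v2, x = F1 v1 + F2 v2) ->
  (forall v1 v2, F1 v1 + F2 v2 = 0 -> G1 v1 + G2 v2 = 0) ->
  exists B : bop W Z, (forall v, B (F1 v) = G1 v) /\ (forall v, B (F2 v) = G2 v).
Proof.
move=> onto wd; have [C C0 CP] := open_mapping2 onto.
have [v1 /choice[v2 vP]] := choice CP.
have fE x w1 w2 : x = F1 w1 + F2 w2 -> G1 (v1 x) + G2 (v2 x) = G1 w1 + G2 w2.
  move=> xw; have [xv _ _] := vP x; apply/eqP; rewrite -subr_eq0 opprD addrACA.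
  rewrite -!linearB /=; apply/eqP/wd; rewrite !linearB /= addrACA -opprD -xw -xv.
  exact: subrr.
have [B BE] : exists B : bop W Z, forall x, B x = G1 (v1 x) + G2 (v2 x).
  apply: (@bop_rnP R W Z _ ((rn G1 + rn G2) * C)).
  - move=> a x y; have [xv _ _] := vP x; have [yv _ _] := vP y.
    rewrite (fE _ (a *: v1 x + v1 y) (a *: v2 x + v2 y)); last first.
      by rewrite !linearP /= addrACA -scalerDr -xv -yv.
    by rewrite !linearP /= addrACA -scalerDr.
  - by rewrite mulr_ge0 // addr_ge0 ?rn_ge0.
  - move=> x; have [_ h1 h2] := vP x; apply: (le_trans (ler_rnD _ _)).
    rewrite -mulrA mulrDl; apply: lerD; apply: (le_trans (rn_bop _ _));
      by rewrite ler_wpM2l ?rn_ge0.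
exists B; split=> v; rewrite BE.
  by rewrite (fE _ v 0) ?linear0 ?addr0.
by rewrite (fE _ 0 v) ?linear0 ?add0r.
Qed.

End OpenMapping.

(** * Drazin invertibility and power series *)

Section DrazinRing.
Variable A : pzRingType.
Implicit Types a b s : A.

Definition drazin a := exists p b, a * b = b * a /\ a ^+ p = a ^+ p.+1 * b.

Lemma drazin_expr a b p k : a * b = b * a -> a ^+ p = a ^+ p.+1 * b ->
  a ^+ (p + k) * b ^+ k = a ^+ p.
Proof.
move=> ab apb; have cab n : a ^+ n * b = b * a ^+ n.
  exact: (commr_sym (commrX n (commr_sym ab))).
elim: k => [|k IH]; first by rewrite addn0 mulr1.
rewrite addnS -addSn exprD (exprS b) -mulrA (mulrA (a ^+ k)) cab -(mulrA b).
by rewrite mulrA -apb mulrA -exprD.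
Qed.

(** The element [b] of [drazin] need not satisfy [b * a * b = b]. Taking [s = a ^+ p * b ^+ p.+1]
    repairs this, and [a * s] is then the idempotent whose complement carries the nilpotent part of
    [a]. *)
Lemma drazin_inverse a : drazin a ->
  exists p s, [/\ a * s = s * a, s * a * s = s & a ^+ p * (1 - a * s) = 0].
Proof.
move=> [p [b [ab apb]]]; have apk k := drazin_expr k ab apb.
have cabn m n : a ^+ n * b ^+ m = b ^+ m * a ^+ n.
  exact: (commr_sym (commrX n (commr_sym (commrX m ab)))).
exists p, (a ^+ p * b ^+ p.+1); split.
- exact: (commrM (commrX p (commr_refl a)) (commrX p.+1 ab)).
- rewrite -!mulrA (mulrA a) -exprS (mulrA (b ^+ p.+1)) -cabn.
  by rewrite !mulrA -exprD apk.
- by rewrite mulrBr mulr1 (mulrA a) -exprS mulrA -exprD apk subrr.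
Qed.

End DrazinRing.

Section BopAlgebra.
Context {R : realType} {X : normedModType R[i]}.
Implicit Types T S : bop X X.

Lemma bopZl a T S : (a *: T) * S = a *: (T * S).
Proof. exact: bop_ext. Qed.

Lemma bopZr a T S : T * (a *: S) = a *: (T * S).
Proof. by apply: bop_ext => x; rewrite /= linearZ. Qed.

Lemma bop_inv_uniq T S S' : S * T = 1 -> T * S' = 1 -> S = S'.
Proof. by move=> ST TS; rewrite -[S]mulr1 -TS mulrA ST mul1r. Qed.

Lemma invertible_drazin T : invertible T -> drazin T.
Proof. by move=> [S [ST TS]]; exists 0%N, S; rewrite ST TS. Qed.

End BopAlgebra.

Section PowerSeries.
Context {R : realType}.

Lemma complex_small (e : R) : 0 < e ->
  exists w : R[i], 0 < rn w < e.
Proof.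
move=> e0; exists (e / 2)%:C; rewrite rnC gtr0_norm; last by lra.
by apply/andP; split; lra.
Qed.

Lemma cvg_series_rn_bounded (V : normedModType R[i]) (u : nat -> V) (x : V) :
  series u @ \oo --> x -> exists2 C : R, 0 <= C & forall n, rn (u n) <= C.
Proof.
move=> /cvg_rnP /(_ 1 ltr01)[N h].
have s0 : 0 <= \sum_(i < N) rn (u i) by apply: sumr_ge0 => i _; exact: rn_ge0.
exists (2 + \sum_(i < N) rn (u i)) => [|n]; first by lra.
have [Nn|nN] := leqP N n.
  have h1 := h _ Nn; have h2 := h _ (leqW Nn).
  have -> : u n = (x - series u n) - (x - series u n.+1).
    by rewrite opprB addrC subrKA series_rec addrC addKr.
  by have := ler_rnB (x - series u n) (x - series u n.+1); lra.
rewrite (bigD1 (Ordinal nN)) //=.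
have : 0 <= \sum_(i < N | i != Ordinal nN) rn (u i).
  by apply: sumr_ge0 => i _; exact: rn_ge0.
lra.
Qed.

Lemma cvg_ps_bound (V : normedModType R[i]) (a : nat -> V) (w : R[i]) (x : V) :
  w != 0 -> series (fun n => w ^+ n *: a n) @ \oo --> x ->
  exists C K : R, [/\ 0 <= C, 0 < K & forall n, rn (a n) <= C * K ^+ n].
Proof.
move=> w0 /cvg_series_rn_bounded[C C0 h].
have rw : 0 < rn w by rewrite rn_gt0.
exists C, (rn w)^-1; split=> [||n] //; first by rewrite invr_gt0.
by rewrite exprVn ler_pdivlMr ?exprn_gt0 // mulrC -rnX -rnZ.
Qed.

Lemma ps_geom (V : normedModType R[i]) (a : nat -> V) (C K : R) (w : R[i]) :
  0 <= C -> 0 < K -> (forall n, rn (a n) <= C * K ^+ n) ->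
  forall n, rn (w ^+ n *: a n) <= C * (rn w * K) ^+ n.
Proof.
move=> C0 K0 h n; rewrite rnZ rnX exprMn mulrCA ler_wpM2l ?exprn_ge0 ?rn_ge0 //.
Qed.

(** Once the coefficients before [n] vanish, dividing the sum by [w ^+ n] leaves [b n] up to a tail
    of order [rn w]. Arbitrarily small nonzero zeros [w] are enough for this. *)
Lemma ps_uniq (V : normedModType R[i]) (b : nat -> V) :
  (forall e : R, 0 < e -> exists w : R[i], 0 < rn w < e /\
     series (fun n => w ^+ n *: b n) @ \oo --> (0 : V)) ->
  forall n, b n = 0.
Proof.
move=> h; have [w0 [/andP[rw0 _] /cvg_ps_bound]] := h 1 ltr01.
rewrite -rn_gt0 => /(_ rw0)[C [K [C0 K0 bCK]]].
elim/ltn_ind => n IH; apply: rn_eq0; apply/ler_addgt0Pr => e e0; rewrite add0r.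
(* The factor 2 bounds the geometric factor [(1 - rn w * K)^-1], as [rn w * K] is kept at most one
   half. *)
pose D := C * K ^+ n.+1 * 2.
have D0 : 0 <= D by rewrite !mulr_ge0 // exprn_ge0 // ltW.
pose d := Num.min ((2 * K)^-1) (e / (D + 1)).
have d0 : 0 < d.
  by rewrite lt_min invr_gt0 mulr_gt0 // divr_gt0 // ltr_wpDl.
have [w [/andP[rw wd] sw]] := h d d0.
have wK : rn w * K <= 2^-1.
  move: wd; rewrite /d lt_min => /andP[+ _]; rewrite invfM ltr_pdivlMr // => h1.
  exact: ltW.
have tail : rn (series (fun n => w ^+ n *: b n) n.+1 - 0) <=
    C * (rn w * K) ^+ n.+1 / (1 - rn w * K).
  have q0 : 0 <= rn w * K by rewrite mulr_ge0 ?rn_ge0 // ltW.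
  have q1 : rn w * K < 1 by apply: le_lt_trans wK _; lra.
  exact: (series_geom_tail q0 q1 (fun m _ => ps_geom w C0 K0 bCK m) sw).
have s0 : series (fun n => w ^+ n *: b n) n = 0.
  by rewrite /series /= big_nat big1 // => i /andP[_ /IH ->]; rewrite scaler0.
move: tail; rewrite series_rec s0 add0r subr0 rnZ rnX exprMn => tail.
have rwn : 0 < rn w ^+ n by rewrite exprn_gt0.
have {tail} : rn w ^+ n * rn (b n) <= rn w ^+ n * (rn w * D).
  apply: (le_trans tail); rewrite ler_pdivrMr; last by lra.
  have -> : C * (rn w ^+ n.+1 * K ^+ n.+1) = (rn w ^+ n * (rn w * D)) / 2.
    by rewrite /D exprS; field.
  have P0 : 0 <= rn w ^+ n * (rn w * D).
    exact: (mulr_ge0 (ltW rwn) (mulr_ge0 (ltW rw) D0)).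
  by rewrite ler_wpM2l //; lra.
rewrite ler_pM2l // => /le_trans; apply.
move: wd; rewrite /d lt_min => /andP[_]; rewrite ltr_pdivlMr; last by lra.
nra.
Qed.

Lemma analytic_atP (V : normedModType R[i]) (f : R[i]^o -> V) z0 :
  analytic_at f z0 <->
  exists a : nat -> V, exists2 r : R, 0 < r & forall w : R[i], rn w < r ->
    series (fun n => w ^+ n *: a n) @ \oo --> f (z0 + w).
Proof.
split=> [[a /nbhs_rnP[r r0 h]]|[a [r r0 h]]]; exists a.
  exists r => // w wr; have := h (z0 + w); rewrite opprD addNKr rnN => /(_ wr).
  by under eq_fun do rewrite addrC addKr.
apply/nbhs_rnP; exists r => // z zr; have := h (z - z0).
by rewrite rnB => /(_ zr); rewrite (addrC z0) subrK.
Qed.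

End PowerSeries.

(** * Poles of the resolvent *)

Section Laurent.
Context {R : realType}.

Lemma cvg_lipschitz (V W : normedModType R[i]) (f : V -> W) (k : R) (u : nat -> V) (x : V) :
  0 <= k -> (forall x y, rn (f x - f y) <= k * rn (x - y)) ->
  u @ \oo --> x -> (fun n => f (u n)) @ \oo --> f x.
Proof.
move=> k0 fk /cvg_rnP ux; apply/cvg_rnP => e e0.
have k1 : 0 < k + 1 by lra.
have [N h] := ux _ (divr_gt0 e0 k1); exists N => n /h.
rewrite ltr_pdivlMr // => hn; apply: le_lt_trans (fk _ _) _.
have := rn_ge0 (x - u n); nra.
Qed.

Variable X : normedModType R[i].
Implicit Types A B G : bop X X.

Lemma cvg_bopMl A (u : nat -> bop X X) G :
  u @ \oo --> G -> (fun n => A * u n) @ \oo --> A * G.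
Proof.
move=> uG; apply: (@cvg_lipschitz _ _ (fun T : bop X X => A * T) _ u G (rn_ge0 A)) => // S T.
by rewrite -mulrBr rn_comp.
Qed.

Lemma cvg_bopMr A (u : nat -> bop X X) G :
  u @ \oo --> G -> (fun n => u n * A) @ \oo --> G * A.
Proof.
move=> uG; apply: (@cvg_lipschitz _ _ (fun T : bop X X => T * A) _ u G (rn_ge0 A)) => // S T.
by rewrite -mulrBl mulrC rn_comp.
Qed.

(* The defect of [a] from being the coefficient sequence of z^p (A - z)^-1. *)
Definition laurent_defect A p (a : nat -> bop X X) n : bop X X :=
  A * a n - (if n is m.+1 then a m else 0) - (n == p)%:R.

Lemma cvg_laurent_defect A p (a : nat -> bop X X) (w : R[i]) G :
  series (fun n => w ^+ n *: a n) @ \oo --> G ->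
  series (fun n => w ^+ n *: laurent_defect A p a n) @ \oo -->
    (A - w *: (1 : bop X X)) * G - w ^+ p *: (1 : bop X X).
Proof.
move=> aG; set u := fun n => w ^+ n *: a n.
(* Multiplying a partial sum by [A - w] telescopes except at the two ends: [t n] comes from the last
   term and tends to 0, and [c n] is the monomial of degree [p], present once [n] exceeds [p]. *)
pose t n : bop X X := if n is m.+1 then w *: u m else 0.
pose c n : bop X X := if (p < n)%N then w ^+ p *: (1 : bop X X) else 0.
have -> : series (fun n => w ^+ n *: laurent_defect A p a n) =
    fun n => (A - w *: (1 : bop X X)) * series u n + t n - c n.
  apply/funext; elim=> [|n IH].
    by rewrite /series /= !big_geq // mulr0 /t /c ltn0 subr0 addr0.
  rewrite !series_rec IH mulrDr /laurent_defect.
  have -> : t n.+1 = w *: u n by [].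
  have -> : (A - w *: (1 : bop X X)) * u n = w ^+ n *: (A * a n) - w *: u n.
    by rewrite mulrBl bopZl mul1r bopZr.
  have -> : c n.+1 = c n + w ^+ n *: ((n == p)%:R : bop X X).
    rewrite /c ltnS; case: ltngtP => [pn|np|->].
    - by rewrite scaler0 addr0.
    - by rewrite scaler0 addr0.
    - by rewrite add0r.
  have -> : t n = w ^+ n *: (if n is m.+1 then a m else 0).
    case: n {IH} => [|n]; first by rewrite /t scaler0.
    by rewrite /t /u scalerA exprS.
  rewrite !scalerBr [RHS]addrAC [_ + (_ - w *: u n)]addrA [RHS]addrAC subrK.
  rewrite [_ - _ - w ^+ n *: _]addrAC [_ - c n]addrAC addrACA subrr addr0.
  by rewrite addrACA opprD.
have ct : t @ \oo --> (0 : bop X X).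
  rewrite -(cvg_shiftS t) /=.
  have -> : (fun n => t n.+1) = fun n => w *: (series u n.+1 - series u n).
    by apply/funext => n; rewrite series_rec addrC addKr.
  rewrite -(scaler0 _ w) -(subrr G); apply: cvgZl_tmp; apply: cvgB => //.
  by rewrite cvg_shiftS.
have cc : c @ \oo --> (w ^+ p *: (1 : bop X X)).
  apply/cvg_rnP => e e0; exists p.+1 => n pn.
  by rewrite /c pn subrr rn0.
rewrite -[X in _ --> X - _]addr0; apply: cvgB => //; apply: cvgD => //.
exact: cvg_bopMl.
Qed.

Lemma laurent_defect_drazin A q (a : nat -> bop X X) :
  (forall n, laurent_defect A q.+1 a n = 0) -> (forall n, A * a n = a n * A) ->
  drazin A.
Proof.
move=> d0 comm.
have aS n : A * a n = (if n is m.+1 then a m else 0) + (n == q.+1)%:R.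
  by apply/eqP; rewrite -subr_eq0 opprD addrA; apply/eqP/d0.
(* Below the order [q.+1] of the pole, multiplication by [A] only lowers the index, and it sends
   [a 0] to 0. So [a q] disappears when [A ^+ q.+1] is applied to [A * a q.+1 = a q + 1]. *)
have kill k : (k <= q)%N -> A ^+ k.+1 * a k = 0.
  elim: k => [|k IH] kq; first by rewrite expr1 aS addr0.
  rewrite exprSr -mulrA aS eqSS ltn_eqF // addr0; exact/IH/ltnW.
exists q.+1, (a q.+1); split=> //.
by rewrite [in RHS]exprSr -mulrA aS eqxx mulrDr mulr1 kill // add0r.
Qed.

End Laurent.

Section Meromorphic.
Context {R : realType}.

Section Coefficients.
Context {X : completeNormedModType R[i]}.
Variables (A S : bop X X) (p : nat).
Hypotheses (AS : A * S = S * A) (SAS : S * A * S = S) (ApS : A ^+ p * (1 - A * S) = 0).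

(** Coefficients of [w ^+ p] times the inverse of [A - w]: on the nilpotent part [1 - A * S] a
    finite sum in powers of [A] over [w], on the complementary part the Neumann series in [S],
    shifted by [p]. *)
Definition drazin_coef n : bop X X :=
  if (n < p)%N then - (A ^+ (p - n.+1) * (1 - A * S)) else S ^+ (n - p).+1.

Lemma drazin_coef_comm n : A * drazin_coef n = drazin_coef n * A.
Proof.
have cS k : A * S ^+ k = S ^+ k * A by apply: commrX.
have c1 : A * (1 - A * S) = (1 - A * S) * A.
  by rewrite mulrBr mulrBl mulr1 mul1r -mulrA -AS.
rewrite /drazin_coef; case: ifP => // _; rewrite mulrN mulNr; congr (- _).
by rewrite -mulrA -c1 !mulrA -exprS exprSr.
Qed.

Lemma drazin_coef_defect n : laurent_defect A p drazin_coef n = 0.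
Proof.
have ASS k : A * S ^+ k.+2 = S ^+ k.+1.
  by rewrite exprS mulrA exprS mulrA AS SAS -exprS.
rewrite /laurent_defect; case: n => [|n].
  rewrite subr0 /drazin_coef; case: p ApS => [|q] Aq.
    rewrite ltnn subnn expr1; move: Aq; rewrite expr0 mul1r => /eqP.
    by rewrite subr_eq0 => /eqP <-; rewrite eqxx subrr.
  by rewrite ltn0Sn subr0 subn1 /= mulrN mulrA -exprS Aq oppr0.
rewrite /drazin_coef; case: (ltngtP n.+1 p) => np.
- rewrite mulrN mulrA -exprS -subSn // subSS opprK addNr.
  by rewrite subr0.
- by rewrite subr0 subSn // ASS subrr.
- by rewrite -np subnn expr1 expr0 mul1r opprK addrCA subrr addr0 subrr.
Qed.

Lemma drazin_coef_bound : exists C K : R, [/\ 0 <= C, 0 < K &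
  forall n, rn (drazin_coef n) <= C * K ^+ n].
Proof.
(* [K] is at least 1 so that the exponent [(n - p).+1] may be raised to [n.+1]; [D] absorbs the
   first [p] coefficients. *)
pose K := 1 + rn S; have K1 : 1 <= K by rewrite /K; have := rn_ge0 S; lra.
pose D := \sum_(i < p) rn (drazin_coef i).
have D0 : 0 <= D by apply: sumr_ge0 => i _; exact: rn_ge0.
have KX n : 1 <= K ^+ n by exact: exprn_ege1.
exists (D + K), K; split=> [||n]; [lra|lra|].
have [np|pn] := ltnP n p.
  apply: (@le_trans _ _ D); last by have := KX n; nra.
  rewrite /D (bigD1 (Ordinal np)) //= lerDl.
  by apply: sumr_ge0 => i _; exact: rn_ge0.
rewrite /drazin_coef ltnNge pn /=.
have SX k : rn (S ^+ k.+1) <= K ^+ k.+1.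
  elim: k => [|k IH]; first by rewrite !expr1 /K; lra.
  rewrite exprS [leRHS]exprS (le_trans (rn_comp _ _)) //.
  by rewrite ler_pM ?rn_ge0 // /K; lra.
apply: (le_trans (SX _)); apply: (@le_trans _ _ (K ^+ n.+1)).
  by apply: ler_weXn2l => //; rewrite ltnS leq_subr.
by rewrite exprS; have := KX n; nra.
Qed.

Lemma drazin_laurent : exists2 r : R, 0 < r & exists g : R[i] -> bop X X,
  g 0 = drazin_coef 0 /\ forall w, rn w < r -> [/\
    series (fun n => w ^+ n *: drazin_coef n) @ \oo --> g w,
    (A - w *: (1 : bop X X)) * g w = w ^+ p *: (1 : bop X X) &
    g w * (A - w *: (1 : bop X X)) = w ^+ p *: (1 : bop X X)].
Proof.
have [C [K [C0 K0 bound]]] := drazin_coef_bound.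
have r0 : 0 < (2 * K)^-1 by rewrite invr_gt0 mulr_gt0.
have conv w : exists l : bop X X, rn w < (2 * K)^-1 ->
    series (fun n => w ^+ n *: drazin_coef n) @ \oo --> l.
  have [wr|] := ltrP (rn w) (2 * K)^-1; last by exists 0.
  have wK : rn w * K < 1.
    by move: wr; rewrite invfM ltr_pdivlMr //; lra.
  have wK0 : 0 <= rn w * K by rewrite mulr_ge0 ?rn_ge0 // ltW.
  have [l wl] := series_geom_cvg wK0 wK (ps_geom w C0 K0 bound).
  by exists l.
have [g gP] := choice conv; exists (2 * K)^-1 => //; exists g.
have comm w : rn w < (2 * K)^-1 -> A * g w = g w * A.
  move=> wr; apply: cvg_rn_unique (cvg_bopMl (A := A) (gP w wr)) _.
  set u := (fun n => w ^+ n *: drazin_coef n).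
  have -> : (fun n => A * series u n) = (fun n => series u n * A).
    apply/funext => n; rewrite /series /= mulr_suml mulr_sumr.
    by apply: eq_bigr => i _; rewrite bopZl bopZr drazin_coef_comm.
  exact: cvg_bopMr (gP w wr).
have left w : rn w < (2 * K)^-1 -> (A - w *: (1 : bop X X)) * g w = w ^+ p *: (1 : bop X X).
  move=> wr; apply/eqP; rewrite -subr_eq0; apply/eqP.
  apply: cvg_rn_unique (cvg_laurent_defect (A := A) (p := p) (gP w wr)) _.
  have -> : series (fun n => w ^+ n *: laurent_defect A p drazin_coef n) = fun=> 0.
    apply/funext => n; rewrite /series /= big1 // => i _.
    by rewrite drazin_coef_defect scaler0.
  exact: cvg_cst.
split.
  have r00 : rn (0 : R[i]) < (2 * K)^-1 by rewrite rn0.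
  apply: cvg_rn_unique (gP 0 r00) _; apply/cvg_rnP => e e0; exists 1%N => -[//|n] _.
  rewrite /series /= big_nat_recl // big1 ?addr0 => [|i _].
    by rewrite scale1r subrr rn0.
  by rewrite exprS mul0r scale0r.
move=> w wr; split; [exact: gP|exact: left|].
by rewrite -left // mulrBl mulrBr bopZl bopZr mul1r mulr1 comm.
Qed.

End Coefficients.

Lemma drazin_punctured_invertible (X : completeNormedModType R[i]) (A : bop X X) :
  drazin A -> exists2 r : R, 0 < r &
    forall w, w != 0 -> rn w < r -> invertible (A - w *: (1 : bop X X)).
Proof.
move=> /drazin_inverse[p [S [AS SAS ApS]]].
have [r r0 [g [_ gP]]] := drazin_laurent AS SAS ApS.
exists r => // w w0 /gP[_ l1 l2]; exists (w ^- p *: g w).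
have wp : w ^+ p != 0 by rewrite expf_neq0.
by rewrite bopZl bopZr l1 l2 scalerA mulVf // scale1r.
Qed.

Lemma invertible_resolvent (X : normedModType R[i]) (T : bop X X) z :
  invertible (T - z *: (1 : bop X X)) ->
  resolvent T z * (T - z *: (1 : bop X X)) = 1 /\ (T - z *: (1 : bop X X)) * resolvent T z = 1.
Proof. by move=> [S SP]; rewrite /resolvent; case: xgetP => [S' _ //|/(_ S)]. Qed.

Lemma drazin_meromorphic (X : completeNormedModType R[i]) (T : bop X X) :
  (forall l : R[i], l != 0 -> drazin (T - l *: (1 : bop X X))) -> meromorphic T.
Proof.
move=> h l l0 Tl; have dA := h l l0; set A := T - l *: (1 : bop X X) in dA.
have TA z : T - z *: (1 : bop X X) = A - (z - l) *: (1 : bop X X).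
  by rewrite scalerBl opprB addrA /A subrK.
have [r r0 rP] := drazin_punctured_invertible dA; split.
  split; first exact/mem_set.
  exists [set z | rn (l - z) < r]; first by apply/nbhs_rnP; exists r.
  apply/seteqP; split=> [z [/= zr Tz]|z ->] /=; last first.
    by rewrite subrr rn0.
  apply/eqP/negPn/negP => zl; apply: Tz; rewrite TA; apply: rP.
    by rewrite subr_eq0.
  by rewrite rnB.
have [p0 [S [AS SAS Ap0]]] := drazin_inverse dA.
(* A minimal [p] is the exact order of the pole: the leading coefficient
   [- (A ^+ p.-1 * (1 - A * S))] is then nonzero, as [pole] demands, and [p] is positive because [l]
   lies in the spectrum. *)
have exp : exists p, A ^+ p * (1 - A * S) == 0 by exists p0; apply/eqP.
case: (ex_minnP exp) => p /eqP Ap pmin.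
have [r' r'0 [g [g0 gP]]] := drazin_laurent AS SAS Ap.
have p_gt0 : (0 < p)%N.
  case: p Ap {pmin g g0 gP} => // /eqP; rewrite expr0 mul1r subr_eq0 => /eqP AS1.
  by exfalso; apply: Tl; exists S; rewrite -AS -AS1.
exists p, (fun z => g (z - l)); split=> //.
- apply/analytic_atP; exists (drazin_coef A S p), r' => // w /gP[+ _ _].
  by rewrite addrAC subrr add0r.
- rewrite subrr g0 /drazin_coef p_gt0 oppr_eq0; apply/negP => /pmin.
  by rewrite leqNgt subn1 prednK // leqnn.
- apply/nbhs_rnP; exists (Num.min r r') => [|z]; first by rewrite lt_min r0.
  rewrite rnB lt_min => /andP[zr /gP[_ g1 g2]] zl.
  have [] := @invertible_resolvent _ T z; rewrite TA.
    by apply: rP; rewrite ?subr_eq0.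
  move=> R1 R2; apply: bop_inv_uniq R1 _.
  rewrite bopZr g1 scalerA mulVf ?scale1r // expf_neq0 // subr_eq0; exact: zl.
Qed.

Lemma meromorphic_drazin (X : normedModType R[i]) (T : bop X X) :
  meromorphic T -> forall l : R[i], l != 0 -> drazin (T - l *: (1 : bop X X)).
Proof.
move=> mT l l0; set A := T - l *: (1 : bop X X).
have TA z : T - z *: (1 : bop X X) = A - (z - l) *: (1 : bop X X).
  by rewrite scalerBl opprB addrA /A subrK.
have [Tl|/contrapT] := pselect (spectrum T l); last exact: invertible_drazin.
have [[_ [U /nbhs_rnP[r1 r10 Ur] UT]] [p [g [p0 /analytic_atP[a [r2 r20 ag]] _]]]] := mT l l0 Tl.
case: p p0 => // q _ /nbhs_rnP[r3 r30 gr].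
have key w : w != 0 -> rn w < Num.min r1 (Num.min r2 r3) ->
    [/\ series (fun n => w ^+ n *: a n) @ \oo --> g (l + w),
        (A - w *: (1 : bop X X)) * g (l + w) = w ^+ q.+1 *: (1 : bop X X) &
        g (l + w) * (A - w *: (1 : bop X X)) = w ^+ q.+1 *: (1 : bop X X)].
  rewrite !lt_min => w0 /and3P[w1 w2 w3].
  have lw : l + w - l = w by rewrite addrAC subrr add0r.
  have [|R1 R2] := @invertible_resolvent _ T (l + w).
    apply: contrapT => /= Tw.
    have : (U `&` spectrum T) (l + w).
      by split=> //; apply: Ur; rewrite opprD addNKr rnN.
    by rewrite UT => /= /eqP; rewrite -subr_eq0 lw (negbTE w0).
  have gE : resolvent T (l + w) = w ^- q.+1 *: g (l + w).
    have := gr (l + w); rewrite opprD addNKr rnN => /(_ w3).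
    by rewrite lw; apply; rewrite -subr_eq0 lw.
  rewrite gE TA lw in R1 R2.
  split; first exact: ag.
  - move: R2; rewrite bopZr => /(congr1 (fun S => w ^+ q.+1 *: S)).
    by rewrite scalerA mulfV ?scale1r // expf_neq0.
  - move: R1; rewrite bopZl => /(congr1 (fun S => w ^+ q.+1 *: S)).
    by rewrite scalerA mulfV ?scale1r // expf_neq0.
have small (e : R) : 0 < e -> exists w : R[i],
    [/\ w != 0, rn w < e & rn w < Num.min r1 (Num.min r2 r3)].
  move=> e0; have [|w] := @complex_small R (Num.min e (Num.min r1 (Num.min r2 r3))).
    by rewrite !lt_min e0 r10 r20.
  by rewrite rn_gt0 lt_min => /and3P[]; exists w.
apply: (@laurent_defect_drazin _ _ A q a).
- apply: ps_uniq => e /small[w [w0 we /(key w w0)[c1 c2 _]]]; exists w.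
  rewrite rn_gt0 w0 we; split=> //.
  by have := cvg_laurent_defect (A := A) (p := q.+1) c1; rewrite c2 subrr.
(* Near [l] the function [g] is a scalar multiple of the resolvent and commutes with [A], so the
   power series of the commutators sums to zero and its coefficients vanish. *)
- move=> n; apply/eqP; rewrite -subr_eq0; apply/eqP; move: n.
  apply: ps_uniq => e /small[w [w0 we /(key w w0)[c1 c2 c3]]]; exists w.
  rewrite rn_gt0 w0 we; split=> //.
  have comm : A * g (l + w) - g (l + w) * A = 0.
    have := c3; rewrite -c2 mulrBl mulrBr bopZl bopZr mul1r mulr1.
    by move=> /addIr ->; rewrite subrr.
  set u := (fun n => w ^+ n *: a n) in c1.
  have -> : series (fun n => w ^+ n *: (A * a n - a n * A)) =
      fun n => A * series u n - series u n * A.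
    apply/funext => k; rewrite /series /= mulr_suml mulr_sumr -sumrB.
    by apply: eq_bigr => i _; rewrite bopZl bopZr -scalerBr.
  rewrite -comm; apply: cvgB; [exact: cvg_bopMl|exact: cvg_bopMr].
Qed.

End Meromorphic.

(** * B-Browder operators *)

Section Composition.
Context {R : realType}.

Section Comp.
Context {V1 V2 V3 : normedModType R[i]} (T : bop V2 V3) (S : bop V1 V2).

Lemma bcomp_subproof : T \o S \in @bop_pred R V1 V3.
Proof.
apply/bopE; split=> [a x y|x]; first by rewrite /= !linearP.
by apply: continuous_comp; exact: bop_continuous.
Qed.

Definition bcomp : bop V1 V3 := Bop bcomp_subproof.
End Comp.

Section Inclusion.
Context {X : normedModType R[i]} (M : csubspace X).

Lemma csub_incl_subproof : (@csub_val R X M) \in @bop_pred R (csub M) X.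
Proof. by apply: (@bounded_bopP _ _ _ _ 1) => // u; rewrite mul1r. Qed.

Definition csub_incl : bop (csub M) X := Bop csub_incl_subproof.

Lemma csub_incl_in (u : csub M) : csub_set M (csub_incl u).
Proof. by apply/csubE; exact: csub_valP. Qed.

Lemma csub_incl_inj u v : csub_incl u = csub_incl v -> u = v.
Proof. exact: val_inj. Qed.

Lemma csub_incl_ex x : csub_set M x -> exists u, csub_incl u = x.
Proof. by move=> /csubE Mx; exists (CSub Mx). Qed.

End Inclusion.

Lemma bker_closed (X : normedModType R[i]) (T : bop X X) : closed (bker T).
Proof.
apply/closed_rnP => x h; apply: rn_eq0; apply/ler_addgt0Pr => e e0; rewrite add0r.
have T1 : 0 < rn T + 1 by have := rn_ge0 T; lra.
have [y Ty] := h _ (divr_gt0 e0 T1); rewrite ltr_pdivlMr // => xy.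
have -> : T x = T (x - y) by rewrite linearB /= Ty subr0.
have := rn_bop T (x - y); have := rn_ge0 (x - y); nra.
Qed.

Lemma bkerP (X : normedModType R[i]) (T : bop X X) x : bker T x <-> T x = 0.
Proof. by []. Qed.

Lemma bker_lin (X : normedModType R[i]) (T : bop X X) a x y :
  bker T x -> bker T y -> bker T (a *: x + y).
Proof. by rewrite /bker /= => Tx Ty; rewrite linearP /= Tx Ty scaler0 addr0. Qed.

Definition bker_csub (X : normedModType R[i]) (T : bop X X) : csubspace X :=
  CSubspace (linear0 T) (@bker_lin X T) (@bker_closed X T).

End Composition.

Section BBrowder.
Context {R : realType} {X : completeNormedModType R[i]}.
Implicit Types T B : bop X X.

Lemma drazin_b_browder T : drazin T -> b_browder T.
Proof.
move=> [p [B [TB Tp]]].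
have TpB n : T ^+ n * B = B * T ^+ n by exact: (commr_sym (commrX n (commr_sym TB))).
have TpBn n m : T ^+ n * B ^+ m = B ^+ m * T ^+ n.
  exact: (commr_sym (commrX n (commr_sym (commrX m TB)))).
have Tpk k := drazin_expr k TB Tp.
(* [T ^+ p * B ^+ p] is a projection with the same range as [T ^+ p]. This makes the range closed;
   [T] is bijective on it, hence Browder there. *)
have rangeE : range (T ^+ p) = bker (1 - T ^+ p * B ^+ p).
  apply/seteqP; split=> [_ [x _ <-]|x].
    by apply/bkerP; rewrite -bopME mulrBl mul1r -mulrA -TpBn mulrA -exprD Tpk subrr.
  by move=> /bkerP/eqP; rewrite subr_eq0 => /eqP xE; exists ((B ^+ p) x).
have cT : closed (range (T ^+ p)) by rewrite rangeE; exact: bker_closed.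
exists p, cT; set Tr := restr _.
have inj u : Tr u = 0 -> u = 0.
  move=> /(congr1 (@csub_incl _ _ _)); rewrite linear0 => h; apply: csub_incl_inj.
  rewrite linear0; have [x _ xu] := csub_incl_in u; rewrite -xu Tp TpB bopME exprS.
  by rewrite bopME xu; move: h; rewrite /csub_incl /= => ->; rewrite linear0.
have surj u : exists v, Tr v = u.
  have [x _ xu] := csub_incl_in u.
  have /csub_incl_ex[v vE] : csub_set (range_csub cT) ((T ^+ p) (B x)) by exists (B x).
  exists v; apply: csub_incl_inj; rewrite -xu; rewrite [LHS]/= -[csub_val v]/(csub_incl _ v) vE.
  by rewrite -!bopME ?mulrA -exprS -Tp.
have ker0 n : bker (Tr ^+ n) = [set 0].
  apply/seteqP; split=> [u|u ->]; last by rewrite /bker /= linear0.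
  elim: n u => [//|n IH] u; rewrite /bker /= exprS bopME => /inj; exact: IH.
have ranT n : range (Tr ^+ n) = setT.
  apply/seteqP; split=> // u _; elim: n u => [|n IH] u; first by exists u.
  by have [v <-] := surj u; have [w _ <-] := IH v; exists w; rewrite // exprS.
split; first split.
- exists 0%N, (fun=> 0); rewrite -[Tr]expr1 ker0.
  apply/seteqP; split=> [u ->|_ [c _ <-]]; last by rewrite big_ord0.
  by exists (fun=> 0) => //; rewrite big_ord0.
- exists 0%N, (fun=> 0) => u; exists (fun=> 0); rewrite -[Tr]expr1 ranT.
  by [].
- by exists 0%N; rewrite !ker0.
- by exists 0%N; rewrite !ranT.
Qed.

Lemma ascent_add T n k : bker (T ^+ n) = bker (T ^+ n.+1) ->
  bker (T ^+ n) = bker (T ^+ (n + k)).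
Proof.
move=> h; elim: k => [|k IH]; first by rewrite addn0.
rewrite IH; apply/seteqP; split=> x /bkerP Tx; apply/bkerP.
  by rewrite addnS exprS bopME Tx linear0.
have : bker (T ^+ n.+1) ((T ^+ k) x).
  by apply/bkerP; rewrite -bopME -exprD addSnnS.
by rewrite -h => /bkerP; rewrite -bopME -exprD.
Qed.

Lemma descent_add T n k : range (T ^+ n) = range (T ^+ n.+1) ->
  range (T ^+ n) = range (T ^+ (n + k)).
Proof.
move=> h; elim: k => [|k IH]; first by rewrite addn0.
apply/seteqP; split=> y; last first.
  by move=> [x _ <-]; exists ((T ^+ k.+1) x) => //; rewrite -bopME -exprD.
rewrite IH => -[x _ <-].
have : range (T ^+ n.+1) ((T ^+ n) x) by rewrite -h; exists x.
move=> [z _ zx]; exists z => //.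
by rewrite addnS -addSn addnC exprD bopME zx -bopME -exprD addnC.
Qed.

(** Finite ascent and descent on the range of [T ^+ n] lift to [T] with an index shift of [n]. Then
    the kernel of [T ^+ p] and the range of [T ^+ p.+1] span [X], and [B] is prescribed as 0 on the
    first and by [T ^+ p.+1 y] to [T ^+ p y] on the second. *)
Lemma b_browder_drazin T : b_browder T -> drazin T.
Proof.
move=> [n [cT [_ [a ha] [d hd]]]]; set Tr := restr _ in ha hd.
have TrX k u : csub_incl _ ((Tr ^+ k) u) = (T ^+ k) (csub_incl _ u).
  elim: k => [//|k IH]; rewrite !exprS !bopME -IH //.
have ker1 : bker (T ^+ (n + a)) = bker (T ^+ (n + a).+1).
  apply/seteqP; split=> x; rewrite /bker /=.
    by rewrite exprS bopME => ->; rewrite linear0.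
  rewrite -addnS addnC exprD bopME => Tx.
  have /csub_incl_ex[u ux] : csub_set (range_csub cT) ((T ^+ n) x) by exists x.
  have : bker (Tr ^+ a.+1) u.
    by apply: csub_incl_inj; rewrite TrX ux Tx linear0.
  rewrite -ha /bker /= => /(congr1 (@csub_incl _ _ _)); rewrite TrX ux linear0.
  by rewrite addnC exprD bopME.
have ran1 : range (T ^+ (n + d)) = range (T ^+ (n + d).+1).
  apply/seteqP; split=> y; last first.
    by move=> [x _ <-]; exists (T x) => //; rewrite -bopME exprSr.
  move=> [x _ <-].
  have /csub_incl_ex[u ux] : csub_set (range_csub cT) ((T ^+ n) x) by exists x.
  have : range (Tr ^+ d.+1) ((Tr ^+ d) u) by rewrite -hd; exists u.
  move=> [v _ /(congr1 (@csub_incl _ _ _))]; rewrite !TrX ux.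
  have [z _ zv] := csub_incl_in v; rewrite -zv => E; exists z => //.
  by rewrite -addnS !(addnC n) !exprD !bopME.
(* Any exponent beyond both stabilization indices would do; the sum makes the two shifts
   symmetric. *)
pose p := ((n + a) + (n + d))%N.
have kerp k : bker (T ^+ p) = bker (T ^+ (p + k)).
  by rewrite -[LHS](ascent_add (n + d) ker1) /p -addnA -[RHS](ascent_add _ ker1).
have ranp k : range (T ^+ p) = range (T ^+ (p + k)).
  rewrite /p [X in T ^+ X](addnC (n + a)) [X in (X + k)%N](addnC (n + a)).
  by rewrite -[LHS](descent_add (n + a) ran1) -addnA -[RHS](descent_add _ ran1).
set K := bker_csub (T ^+ p).
have Ku (u : csub K) : (T ^+ p) (csub_incl K u) = 0 by apply/bkerP; exact: (csub_incl_in u).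
have decomp x : exists (u : csub K) y, x = csub_incl K u + (T ^+ p.+1) y.
  have : range (T ^+ p) ((T ^+ p) x) by exists x.
  rewrite (ranp p.+1) => -[y _ yx].
  have /csub_incl_ex[u uE] : csub_set K (x - (T ^+ p.+1) y).
    by apply/bkerP; rewrite linearB /= -yx -bopME -exprD subrr.
  by exists u, y; rewrite uE subrK.
have [//|u y uy|B [B1 B2]] := @bop_factor R (csub K) X X X (csub_incl K) (T ^+ p.+1) 0 (T ^+ p).
  rewrite bop0E add0r; suff : bker (T ^+ p) y by [].
  rewrite (kerp p.+1); apply/bkerP; rewrite exprD bopME.
  have : (T ^+ p) (csub_incl K u + (T ^+ p.+1) y) = 0 by rewrite uy linear0.
  by rewrite linearD /= Ku add0r.
exists p, B; split; apply: bop_ext => x; have [u [y ->]] := decomp x.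
  have /csub_incl_ex[v vE] : csub_set K (T (csub_incl K u)).
    by apply/bkerP; rewrite -bopME -exprSr exprS bopME Ku linear0.
  rewrite !bopME linearD /= B1 B2 bop0E add0r linearD /= -vE linearD /= B1 bop0E add0r.
  by rewrite -[T ((T ^+ p.+1) y)]bopME -exprS exprSr bopME B2 -!bopME -exprS -exprSr.
rewrite bopME linearD /= [in RHS]linearD /= B1 B2 bop0E add0r Ku add0r.
by rewrite -!bopME -!exprD addSnnS.
Qed.

End BBrowder.

(** * Direct sums *)

Section Splitting.
Context {R : realType}.

(** A topological direct sum given by bounded injections and projections. Identities between
    operators that respect it can then be checked block by block, without referring to subspaces. *)
Record splitting (X V1 V2 : normedModType R[i]) := Splitting {
  inj1 : bop V1 X; inj2 : bop V2 X; prj1 : bop X V1; prj2 : bop X V2;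
  prj1K : forall v, prj1 (inj1 v) = v;
  prj2K : forall v, prj2 (inj2 v) = v;
  prj12 : forall v, prj1 (inj2 v) = 0;
  prj21 : forall v, prj2 (inj1 v) = 0;
  splitE : forall x, inj1 (prj1 x) + inj2 (prj2 x) = x }.

Section Theory.
Context {X V1 V2 : normedModType R[i]} (s : splitting X V1 V2).

Definition splits (T : bop X X) (T1 : bop V1 V1) (T2 : bop V2 V2) :=
  (forall v, T (inj1 s v) = inj1 s (T1 v)) /\ (forall v, T (inj2 s v) = inj2 s (T2 v)).

Lemma splits_ext T S T1 T2 : splits T T1 T2 -> splits S T1 T2 -> T = S.
Proof.
move=> [t1 t2] [s1 s2]; apply: bop_ext => x.
by rewrite -(splitE s x) !linearD /= t1 t2 s1 s2.
Qed.

Lemma splits_uniq T T1 T2 S1 S2 : splits T T1 T2 -> splits T S1 S2 -> T1 = S1 /\ T2 = S2.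
Proof.
move=> [t1 t2] [s1 s2]; split; apply: bop_ext => v.
  by rewrite -(prj1K s (T1 v)) -t1 s1 prj1K.
by rewrite -(prj2K s (T2 v)) -t2 s2 prj2K.
Qed.

Definition glue (T1 : bop V1 V1) (T2 : bop V2 V2) : bop X X :=
  bcomp (inj1 s) (bcomp T1 (prj1 s)) + bcomp (inj2 s) (bcomp T2 (prj2 s)).

Lemma splits_glue T1 T2 : splits (glue T1 T2) T1 T2.
Proof.
split=> v; rewrite bopDE /=.
  by rewrite prj1K prj21 !linear0 addr0.
by rewrite prj2K prj12 !linear0 add0r.
Qed.

Lemma splits1 : splits 1 1 1.
Proof. by split=> v; rewrite !bop1E. Qed.

Lemma splits_add T S T1 S1 T2 S2 :
  splits T T1 T2 -> splits S S1 S2 -> splits (T + S) (T1 + S1) (T2 + S2).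
Proof.
move=> [t1 t2] [s1 s2].
by split=> v; rewrite !bopDE ?t1 ?s1 ?t2 ?s2 linearD.
Qed.

Lemma splits_opp T T1 T2 : splits T T1 T2 -> splits (- T) (- T1) (- T2).
Proof. by move=> [t1 t2]; split=> v; rewrite !bopNE ?t1 ?t2 linearN. Qed.

Lemma splits_sub T S T1 S1 T2 S2 :
  splits T T1 T2 -> splits S S1 S2 -> splits (T - S) (T1 - S1) (T2 - S2).
Proof. by move=> sT sS; apply: splits_add sT _; exact: splits_opp. Qed.

Lemma splits_scale a T T1 T2 : splits T T1 T2 -> splits (a *: T) (a *: T1) (a *: T2).
Proof. by move=> [t1 t2]; split=> v; rewrite !bopZE ?t1 ?t2 linearZ. Qed.

Lemma splits_mul T S T1 S1 T2 S2 :
  splits T T1 T2 -> splits S S1 S2 -> splits (T * S) (T1 * S1) (T2 * S2).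
Proof.
by move=> [t1 t2] [s1 s2]; split=> v; rewrite !bopME ?s1 ?s2 ?t1 ?t2.
Qed.

Lemma splits_exp T T1 T2 n : splits T T1 T2 -> splits (T ^+ n) (T1 ^+ n) (T2 ^+ n).
Proof.
move=> sT; elim: n => [|n IH]; first exact: splits1.
by rewrite !exprS; exact: splits_mul.
Qed.

Lemma splits_shift T T1 T2 (l : R[i]) : splits T T1 T2 ->
  splits (T - l *: (1 : bop X X)) (T1 - l *: (1 : bop V1 V1)) (T2 - l *: (1 : bop V2 V2)).
Proof. by move=> sT; apply: splits_sub => //; apply: splits_scale; exact: splits1. Qed.

Lemma splits_prj T T1 T2 x : splits T T1 T2 ->
  prj1 s (T x) = T1 (prj1 s x) /\ prj2 s (T x) = T2 (prj2 s x).
Proof.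
move=> [t1 t2]; have -> : T x = inj1 s (T1 (prj1 s x)) + inj2 s (T2 (prj2 s x)).
  by rewrite -{1}(splitE s x) linearD /= t1 t2.
by rewrite !linearD /= prj1K prj2K prj12 prj21 addr0 add0r.
Qed.

(** [glue 1 0] is the projection onto the first summand; commuting with it removes the off-diagonal
    blocks. *)
Lemma splits_comm (T : bop X X) : T * glue 1 0 = glue 1 0 * T -> exists T1 T2, splits T T1 T2.
Proof.
set Q := glue 1 0; move=> TQ.
have QE x : Q x = inj1 s (prj1 s x) by rewrite bopDE /= linear0 addr0.
have TQE x : T (Q x) = Q (T x) by rewrite -!bopME TQ.
exists (bcomp (prj1 s) (bcomp T (inj1 s))), (bcomp (prj2 s) (bcomp T (inj2 s))).
split=> v; rewrite /=.
  by rewrite -QE -TQE QE prj1K.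
rewrite -[LHS](splitE s) -QE -TQE QE prj12 !linear0 add0r //.
Qed.

(** The witness [B] for [T] is not known to respect the splitting, but its diagonal blocks still
    work, since [T] does. Conversely the two exponents are added so that one exponent serves both
    summands. *)
Lemma splits_drazin T T1 T2 : splits T T1 T2 ->
  drazin T <-> drazin T1 /\ drazin T2.
Proof.
move=> sT; split.
  move=> [p [B [TB Tp]]].
  pose B1 := bcomp (prj1 s) (bcomp B (inj1 s)).
  pose B2 := bcomp (prj2 s) (bcomp B (inj2 s)).
  have sTp k := splits_exp k sT.
  split.
    exists p, B1; split; apply: bop_ext => v; rewrite /B1.
      rewrite !bopME /= -(splits_prj _ sT).1 -sT.1.
      by rewrite -[T (B _)]bopME TB.
    rewrite bopME /= -(splits_prj _ (sTp _)).1 -bopME -Tp (sTp p).1 prj1K //.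
  exists p, B2; split; apply: bop_ext => v; rewrite /B2.
    rewrite !bopME /= -(splits_prj _ sT).2 -sT.2.
    by rewrite -[T (B _)]bopME TB.
  by rewrite bopME /= -(splits_prj _ (sTp _)).2 -bopME -Tp (sTp p).2 prj2K.
move=> [[p [B1 [TB1 Tp1]]] [q [B2 [TB2 Tq2]]]].
exists (p + q)%N, (glue B1 B2); have sB := splits_glue B1 B2; split.
  by apply: splits_ext (splits_mul sT sB) _; rewrite TB1 TB2; exact: splits_mul.
apply: splits_ext (splits_exp _ sT) _.
have -> : T1 ^+ (p + q) = T1 ^+ (p + q).+1 * B1.
  by rewrite addnC exprD Tp1 mulrA -exprD addnS.
have -> : T2 ^+ (p + q) = T2 ^+ (p + q).+1 * B2.
  by rewrite exprD Tq2 mulrA -exprD addnS.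
by apply: splits_mul => //; exact: splits_exp.
Qed.

End Theory.

Definition mero (V : normedModType R[i]) (T : bop V V) :=
  forall l : R[i], l != 0 -> drazin (T - l *: (1 : bop V V)).

Lemma meroP (V : completeNormedModType R[i]) (T : bop V V) : meromorphic T <-> mero T.
Proof. by split; [exact: meromorphic_drazin|exact: drazin_meromorphic]. Qed.

Lemma splits_mero (X V1 V2 : normedModType R[i]) (s : splitting X V1 V2) T T1 T2 :
  splits s T T1 T2 -> mero T <-> mero T1 /\ mero T2.
Proof.
move=> sT; split=> [mT|[m1 m2] l l0].
  by split=> l l0; have [] := (splits_drazin (splits_shift l sT)).1 (mT l l0).
by apply: (splits_drazin (splits_shift l sT)).2; split; [exact: m1|exact: m2].
Qed.

Lemma drazinN (V : normedModType R[i]) (T : bop V V) : drazin T -> drazin (- T).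
Proof.
move=> [p [B [TB Tp]]]; exists p, (- B); split.
  by rewrite !mulrNN.
rewrite !(exprNn T) -mulrA mulrN -Tp exprS mulN1r mulNr mulrN opprK //.
Qed.

Lemma meroN (V : normedModType R[i]) (T : bop V V) : mero T -> mero (- T).
Proof.
move=> mT l l0; rewrite -[X in drazin X]opprK opprB opprK addrC.
apply: drazinN; have := mT (- l); rewrite oppr_eq0 => /(_ l0).
by rewrite scaleNr opprK.
Qed.

(** Every nonzero shift is invertible: [T - l] divides [T ^+ n - l ^+ n], which is a nonzero scalar
    here. *)
Lemma nilpotent_mero (V : normedModType R[i]) (T : bop V V) n :
  T ^+ n = 0 -> mero T.
Proof.
move=> Tn l l0; apply: invertible_drazin.
set L := l *: (1 : bop V V).
have TL : GRing.comm T L by rewrite /GRing.comm /L bopZl bopZr mul1r mulr1.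
have LX k : L ^+ k = l ^+ k *: (1 : bop V V).
  elim: k => [|k IH]; first by rewrite !expr0 scale1r.
  by rewrite !exprS IH /L bopZl mul1r scalerA.
have ln : l ^+ n != 0 by rewrite expf_neq0.
set Z := \sum_(i < n) T ^+ (n.-1 - i) * L ^+ i.
have ZE : (T - L) * Z = - (l ^+ n *: (1 : bop V V)).
  by rewrite -subrXX_comm // Tn sub0r LX.
have ZC : GRing.comm (T - L) Z.
  apply: commr_sum => i _; apply: commrM; apply: commrX.
    by apply/commr_sym/commrB => //; exact: commr_sym.
  by apply/commr_sym/commrB => //; apply: commr_sym.
exists (- (l ^- n *: Z)); split.
  by rewrite mulNr bopZl -ZC ZE scalerN opprK scalerA mulVf // scale1r.
by rewrite mulrN bopZr ZE scalerN opprK scalerA mulVf // scale1r.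
Qed.

(** [Red] is a purely algebraic sum of closed subspaces. Its projections become bounded through
    [bop_factor], applied to the two inclusions with targets [(1, 0)] and [(0, 1)]. *)
Lemma red_split (X : completeNormedModType R[i]) (T : bop X X) (d : Red T) :
  exists s : splitting X (csub (redM d)) (csub (redN d)),
    [/\ inj1 s = csub_incl (redM d), inj2 s = csub_incl (redN d) &
        splits s T (restrM d) (restrN d)].
Proof.
set M := redM d; set N := redN d.
have onto x : exists (u : csub M) (v : csub N), x = csub_incl M u + csub_incl N v.
  have [y [z [My Nz ->]]] := red_sum d x.
  by have [u <-] := csub_incl_ex My; have [v <-] := csub_incl_ex Nz; exists u, v.
have uniq (u : csub M) (v : csub N) : csub_incl M u + csub_incl N v = 0 -> u = 0 /\ v = 0.
  move=> uv; have uE : csub_incl M u = csub_incl N (- v).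
    by apply/eqP; rewrite linearN -subr_eq0 opprK uv.
  have u0 : csub_incl M u = 0.
    suff : (redM d `&` redN d) (csub_incl M u) by rewrite red_cap.
    by split; [exact: csub_incl_in|rewrite uE; exact: csub_incl_in].
  split; apply: csub_incl_inj; rewrite linear0 //.
  by move: uv; rewrite u0 add0r.
have [//|u v /uniq[-> _]|P1 [P1M P1N]] :=
    bop_factor (F1 := csub_incl M) (F2 := csub_incl N) (G1 := 1) (G2 := 0).
  by rewrite linear0 bop0E addr0.
have [//|u v /uniq[_ ->]|P2 [P2M P2N]] :=
    bop_factor (F1 := csub_incl M) (F2 := csub_incl N) (G1 := 0) (G2 := 1).
  by rewrite linear0 bop0E addr0.
have E x : csub_incl M (P1 x) + csub_incl N (P2 x) = x.
  by have [u [v ->]] := onto x; rewrite !linearD /= P1M P1N P2M P2N addr0 add0r.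
exists (Splitting P1M P2N P1N P2M E); split=> //.
Qed.

(** The range of [Q] is taken as the kernel of [1 - Q], so both summands are closed as kernels. *)
Lemma projection_red (X : normedModType R[i]) (T Q : bop X X) :
  projection Q -> Q * T = T * Q ->
  exists d : Red T, (forall x, csub_set (redM d) x -> Q x = x) /\
    (forall x, csub_set (redN d) x -> Q x = 0).
Proof.
move=> QQ QT.
have QTx x : Q (T x) = T (Q x) by rewrite -!bopME QT.
have kerQ x : bker (1 - Q) x <-> Q x = x.
  rewrite bkerP bopDE bopNE bop1E; split=> [/eqP|->]; last by rewrite subrr.
  by rewrite subr_eq0 => /eqP.
have inv1 : Defs.invariant T (bker_csub (1 - Q)).
  by move=> x /kerQ Qx; apply/kerQ; rewrite QTx Qx.
have inv2 : Defs.invariant T (bker_csub Q).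
  by move=> x /bkerP Qx; apply/bkerP; rewrite QTx Qx linear0.
have cap : bker_csub (1 - Q) `&` bker_csub Q = [set 0].
  apply/seteqP; split=> [x [/kerQ Qx /bkerP Qx0]|x ->]; first by rewrite -Qx Qx0.
  by split; [apply/kerQ; rewrite linear0|apply/bkerP; rewrite linear0].
have sum x : exists y z,
    [/\ csub_set (bker_csub (1 - Q)) y, csub_set (bker_csub Q) z & x = y + z].
  exists (Q x), (x - Q x); split; last by rewrite addrC subrK.
    by apply/kerQ; rewrite -bopME QQ.
  by apply/bkerP; rewrite linearB /= -bopME QQ subrr.
by exists (MkRed inv1 inv2 cap sum); split=> x; [move/kerQ|move/bkerP].
Qed.

Lemma projection_split (X : completeNormedModType R[i]) (T Q : bop X X) :
  projection Q -> Q * T = T * Q ->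
  exists (d : Red T) (s : splitting X (csub (redM d)) (csub (redN d))),
    splits s T (restrM d) (restrN d) /\ splits s Q 1 0.
Proof.
move=> QQ QT; have [d [dM dN]] := projection_red QQ QT.
have [s [s1 s2 sT]] := red_split d; exists d, s; split=> //; split=> v.
  by rewrite s1 bop1E dM //; exact: csub_incl_in.
by rewrite s2 bop0E linear0 dN //; exact: csub_incl_in.
Qed.

End Splitting.

(** * Comparison of the decompositions *)

Section Equivalences.
Context {R : realType} {X : completeNormedModType R[i]}.
Implicit Type T : bop X X.

Definition invertible_meromorphic_sum T :=
  exists d : Red T, invertible (restrM d) /\ meromorphic (restrN d).

Lemma b_browderP (V : completeNormedModType R[i]) (T : bop V V) :
  b_browder T <-> drazin T.
Proof. by split; [exact: b_browder_drazin|exact: drazin_b_browder]. Qed.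

Lemma invertible1 (V : normedModType R[i]) : invertible (1 : bop V V).
Proof. by exists 1; rewrite mulr1. Qed.

(** The Drazin inverse of T_M glued with 0 works: the defect [T * S * T - T] is nilpotent on [M] and
    equals minus T_N on [N], and both are meromorphic. *)
Lemma sum_drazin_meromorphic_inverse T :
  (exists d : Red T, b_browder (restrM d) /\ meromorphic (restrN d)) ->
  gen_drazin_meromorphic_invertible T.
Proof.
move=> [d [/b_browderP/drazin_inverse[p [S [TS STS TpS]]] /meroP mN]].
have [s [_ _ sT]] := red_split d; set T1 := restrM d in TS STS TpS sT.
have sS := splits_glue s S 0; exists (glue s S 0); split.
- by apply: splits_ext (splits_mul sT sS) _; rewrite TS mulr0 -(mul0r (restrN d)); exact: splits_mul.
- apply: splits_ext (splits_mul (splits_mul sS sT) sS) _.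
  by rewrite STS mulr0.
- apply/meroP/(splits_mero (splits_sub (splits_mul (splits_mul sT sS) sT) sT)).2.
  rewrite mulr0 mul0r sub0r; split; last exact: meroN.
  have TSC : GRing.comm T1 (1 - T1 * S).
    by apply: commrB; [exact: commr1|rewrite /GRing.comm TS mulrA -TS].
  have -> : T1 * S * T1 - T1 = - (T1 * (1 - T1 * S)).
    by rewrite TSC mulrBl mul1r opprB.
  (* The exponent is [p.+1] rather than [p] so that a factor [1 - T1 * S] is present even when [p]
     is 0. *)
  apply/meroN/(@nilpotent_mero _ _ _ p.+1).
  rewrite exprMn_comm // exprS [in X in _ * X]exprS mulrA -(mulrA T1) TpS.
  by rewrite mulr0 mul0r.
Qed.

Lemma sum_invertible_drazin T : invertible_meromorphic_sum T ->
  exists d : Red T, b_browder (restrM d) /\ meromorphic (restrN d).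
Proof.
move=> [d [iM mN]]; exists d; split=> //.
by apply/b_browderP; exact: invertible_drazin.
Qed.

(** For the idempotent [Q = T * S], the operator [S] inverts [T] on the range of [Q], while on its
    kernel [T * S * T - T] reduces to [- T]. *)
Lemma meromorphic_inverse_sum T :
  gen_drazin_meromorphic_invertible T -> invertible_meromorphic_sum T.
Proof.
move=> [S [TS STS /meroP mT]]; set Q := T * S.
have QQ : projection Q by rewrite /projection /Q -mulrA (mulrA S) STS.
have QT : Q * T = T * Q by rewrite /Q -mulrA -TS.
have QS : Q * S = S * Q by rewrite /Q mulrA -TS.
have [d [s [sT sQ]]] := projection_split QQ QT; exists d.
have Qglue : Q = glue s 1 0 := splits_ext sQ (splits_glue s 1 0).
have [S1 [S2 sS]] : exists S1 S2, splits s S S1 S2.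
  by apply: splits_comm; rewrite -Qglue QS.
have [TS1 _] := splits_uniq (splits_mul sT sS) sQ.
have sQ' : splits s (S * T) 1 0 by rewrite -TS.
have [ST1 _] := splits_uniq (splits_mul sS sT) sQ'.
split; first by exists S1.
have := (splits_mero (splits_sub (splits_mul sQ sT) sT)).1 mT.
by rewrite mul0r sub0r => -[_ /meroN]; rewrite opprK => /meroP.
Qed.

Lemma meromorphic_inverse_quasi_polar T :
  gen_drazin_meromorphic_invertible T <-> meromorphic_quasi_polar T.
Proof.
split=> [[S [TS STS /meroP mT]]|[Q [QQ TQ /meroP mT [U [V [QU QV]]]]]].
  exists (T * S); split.
  - by rewrite /projection -mulrA (mulrA S) STS.
  - by rewrite -[RHS]mulrA -TS.
  - apply/meroP; rewrite mulrBr mulr1 {1}TS mulrA -opprB; exact: meroN.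
  - by exists S, S.
(* Both sides are [U * T * V]; thus a left and a right inverse of [T] relative to [Q] agree, and
   their common value is the generalized inverse. *)
have UQ : Q * V = U * Q by rewrite {1}QU QV mulrA.
have TS : T * (Q * V) = Q by rewrite mulrA TQ -mulrA -QV QQ.
have ST : Q * V * T = Q by rewrite UQ -mulrA -TQ mulrA -QU QQ.
exists (Q * V); split; first by rewrite TS ST.
  by rewrite ST mulrA QQ.
apply/meroP; rewrite TS -TQ -opprB; apply: meroN.
by move: mT; rewrite mulrBr mulr1.
Qed.

Lemma sum_splitting T : invertible_meromorphic_sum T ->
  exists (d : Red T) (s : splitting X (csub (redM d)) (csub (redN d))),
  [/\ splits s T (restrM d) (restrN d), invertible (restrM d) & mero (restrN d)].
Proof.
move=> [d [iM /meroP mN]]; have [s [_ _ sT]] := red_split d.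
by exists d, s.
Qed.

(** With [P] the projection onto [N], the operator [T + P] is T_M on [M] and T_N - (-1) on [N]. *)
Lemma sum_projection_add T : invertible_meromorphic_sum T ->
  exists P : bop X X, [/\ projection P, P * T = T * P, meromorphic (T * P) &
    b_browder (T + P)].
Proof.
move=> /sum_splitting[d [s [sT iM mN]]]; exists (glue s 0 1).
have sP := splits_glue s 0 1; split.
- by apply: splits_ext (splits_mul sP sP) _; rewrite mulr0 mulr1.
- apply: splits_ext (splits_mul sP sT) _.
  by have := splits_mul sT sP; rewrite !mulr0 !mul0r mul1r mulr1.
- apply/meroP/(splits_mero (splits_mul sT sP)).2; rewrite mulr0 mulr1; split=> //.
  by apply: (nilpotent_mero (n := 1)); rewrite expr1.
- apply/b_browderP/(splits_drazin (splits_add sT sP)).2; rewrite addr0.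
  split; first exact: invertible_drazin.
  have := mN (-1); rewrite oppr_eq0 oner_eq0 => /(_ isT).
  by rewrite scaleN1r opprK.
Qed.

Lemma sum_projection_mul T : invertible_meromorphic_sum T ->
  exists P : bop X X, [/\ projection P, P * T = T * P, meromorphic (T * P) &
    b_browder (T * (1 - P) + P)].
Proof.
move=> /sum_splitting[d [s [sT iM mN]]]; exists (glue s 0 1).
have sP := splits_glue s 0 1; split.
- by apply: splits_ext (splits_mul sP sP) _; rewrite mulr0 mulr1.
- apply: splits_ext (splits_mul sP sT) _.
  by have := splits_mul sT sP; rewrite !mulr0 !mul0r mul1r mulr1.
- apply/meroP/(splits_mero (splits_mul sT sP)).2; rewrite mulr0 mulr1; split=> //.
  by apply: (nilpotent_mero (n := 1)); rewrite expr1.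
- have sQ := splits_sub (splits1 s) sP.
  apply/b_browderP/(splits_drazin (splits_add (splits_mul sT sQ) sP)).2.
  rewrite subr0 mulr1 addr0 subrr mulr0 add0r.
  by split; apply: invertible_drazin => //; exact: invertible1.
Qed.

(** The boolean treats [T + P] and [T * (1 - P) + P] together: both coincide with [T] on the kernel
    of [P], and [T * P] is [T] on its range. *)
Lemma projection_sum T P (b : bool) :
  projection P -> P * T = T * P -> meromorphic (T * P) ->
  b_browder (T * (if b then 1 - P else 1) + P) ->
  exists d : Red T, b_browder (restrM d) /\ meromorphic (restrN d).
Proof.
move=> PP PT /meroP mTP /b_browderP dTP.
have QQ : projection (1 - P).
  by rewrite /projection mulrBr mulr1 mulrBl mul1r PP subrr subr0.
have QT : (1 - P) * T = T * (1 - P) by rewrite mulrBl mulrBr mul1r mulr1 PT.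
have [d [s [sT sQ]]] := projection_split QQ QT; exists d.
have sP : splits s P 0 1.
  by have := splits_sub (splits1 s) sQ; rewrite opprB addrCA subrr addr0 subrr subr0.
split.
  have sR : splits s (if b then 1 - P else 1) 1 (if b then 0 else 1).
    by case: b {dTP} => //; exact: splits1.
  apply/b_browderP; have := (splits_drazin (splits_add (splits_mul sT sR) sP)).1 dTP.
  by rewrite mulr1 addr0 => -[].
by apply/meroP; have [_] := (splits_mero (splits_mul sT sP)).1 mTP; rewrite mulr1.
Qed.

Lemma kato_invertible (V : normedModType R[i]) (T : bop V V) : invertible T -> kato T.
Proof.
move=> [S [ST TS]].
have -> : kato T = (closed [set: V] /\ forall n, bker T `<=` range (T ^+ n)).
  congr (closed _ /\ _); apply/seteqP; split=> // x _; exists (S x) => //.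
  by rewrite -bopME TS.
split; first exact: closedT.
move=> n x /bkerP Tx; exists 0 => //; rewrite linear0.
by rewrite -[x]bop1E -ST bopME Tx linear0.
Qed.

Lemma sum_kato T : invertible_meromorphic_sum T -> gen_kato_meromorphic T.
Proof. by move=> [d [iM mN]]; exists d; split=> //; exact: kato_invertible. Qed.

(** For small nonzero [l] the shift of T_M stays invertible, and the shift of T_N is Drazin
    invertible for every nonzero [l]. *)
Lemma sum_not_limit_point T : invertible_meromorphic_sum T ->
  ~ limit_point (b_browder_spectrum T) 0.
Proof.
move=> /sum_splitting[d [s [sT iM mN]]].
have [r r0 rP] := drazin_punctured_invertible (invertible_drazin iM).
move=> /(_ [set l | rn l < r])[|l [l0 Tl lr]].
  by apply/nbhs_rnP; exists r => // y; rewrite sub0r rnN.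
apply: Tl; apply/b_browderP/(splits_drazin (splits_shift l sT)).2.
by split; [apply: invertible_drazin; exact: rP|exact: mN].
Qed.

Lemma not_limit_point_not_interior (A : set R[i]^o) : ~ limit_point A 0 -> ~ A° 0.
Proof.
move=> nA /nbhs_rnP[r r0 rA]; apply: nA => U /nbhs_rnP[r' r'0 rU].
have [|w] := @complex_small R (Num.min r r'); first by rewrite lt_min r0.
rewrite rn_gt0 lt_min => /and3P[w0 wr wr']; exists w.
by split=> //; [apply: rA|apply: rU]; rewrite sub0r rnN.
Qed.

(** A B-Browder point has resolvent points arbitrarily close to it. Halving the radius keeps these
    inside the disc assumed to lie in the spectrum. *)
Lemma interior_b_browder_spectrum T : (spectrum T)° 0 -> (b_browder_spectrum T)° 0.
Proof.
move=> /nbhs_rnP[r r0 rT]; apply/nbhs_rnP; exists (r / 2); first by lra.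
move=> l; rewrite sub0r rnN => lr /b_browderP/drazin_punctured_invertible[e e0 eT].
have [|w] := @complex_small R (Num.min e (r / 2)); first by rewrite lt_min e0 /=; lra.
rewrite rn_gt0 lt_min => /and3P[w0 we wr].
apply: (rT (l + w)); first by rewrite sub0r rnN; have := ler_rnD l w; lra.
by rewrite scalerDl opprD addrA; exact: eT.
Qed.

End Equivalences.

(** * Analytic functions and the SVEP *)

Section ComplexComplete.
Context {R : realType}.

Lemma rnRe (z : R[i]) : `|complex.Re z| <= rn z.
Proof.
by case: z => a b; rewrite /rn normc_def /= -[leLHS]sqrtr_sqr ler_wsqrtr // lerDl sqr_ge0.
Qed.

Lemma rnIm (z : R[i]) : `|complex.Im z| <= rn z.
Proof.
by case: z => a b; rewrite /rn normc_def /= -[leLHS]sqrtr_sqr ler_wsqrtr // lerDr sqr_ge0.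
Qed.

Lemma rn_le_ReIm (z : R[i]) : rn z <= `|complex.Re z| + `|complex.Im z|.
Proof.
rewrite {1}[z]complexE (le_trans (ler_rnD _ _)) // rnM !rnC.
by rewrite /rn normc_def /= expr0n expr1n /= add0r sqrtr1 mul1r.
Qed.

Lemma complex_complete (F : set_system R[i]^o) : ProperFilter F -> cauchy F -> cvg F.
Proof.
move=> FF Fc.
have part (g : R[i] -> R) : (forall z w, g (z - w) = g z - g w) ->
    (forall z, `|g z| <= rn z) -> exists l : R, (g : R[i]^o -> R^o) @ F --> (l : R^o).
  move=> gB g_le; have : cvg ((g : R[i]^o -> R^o) @ F); last by move=> /cvg_ex.
  apply: cauchy_cvg; apply: cauchy_exP => e e0.
  have e0' : 0 < e%:C :> R[i] by rewrite ltcR.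
  move/cauchy_ballP : (Fc) => /(_ e%:C e0')[[A B] /= [FA FB] AB].
  have [z Az] := @filter_ex _ F _ _ FA; exists (g z).
  apply: (@filterS _ F _ B) => //= w Bw; rewrite -ball_normE /= -gB.
  have := AB (z, w) (conj Az Bw); rewrite /= -ball_normE /= rnE ltcR.
  exact: le_lt_trans.
have [|//|a Fa] := part (@complex.Re R); first by move=> [? ?] [? ?].
  exact: rnRe.
have [|//|b Fb] := part (@complex.Im R); first by move=> [? ?] [? ?].
  exact: rnIm.
apply/cvg_ex; exists (a +i* b : R[i]^o) => U /nbhs_rnP[e e0 eU].
have e2 : 0 < e / 2 by lra.
move/cvgrPdist_lt: Fa => /(_ _ e2) hA; move/cvgrPdist_lt: Fb => /(_ _ e2) hB.
apply: (@filterS _ F _ _ _ _ (@filterI _ F _ _ _ hA hB)) => z [/= za zb].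
apply: eU; apply: le_lt_trans (rn_le_ReIm _) _.
by case: z za zb => c d /= za zb; lra.
Qed.

(** The dual packaged with its completeness, so that [svep_chain] can be applied to the adjoint. *)
Definition complete_dual (X : normedModType R[i]) : completeNormedModType R[i] :=
  HB.pack (bop X R[i]^o)
    (Uniform_isComplete.Build (bop X R[i]^o) (bop_complete_of complex_complete)).

End ComplexComplete.

Section Expansion.
Context {R : realType}.

(** For [n] beyond [k] the binomial coefficient is 0, so the truncated subtraction is harmless and
    sums may run to any bound above [k]. *)
Definition binom_term (K : comPzRingType) (x y : K) k n := x ^+ (k - n) * y ^+ n *+ 'C(k, n).

Lemma sum_binom_term (K : comPzRingType) (x y : K) k N : (k < N)%N ->
  \sum_(n < N) binom_term x y k n = (x + y) ^+ k.
Proof.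
move=> kN; rewrite exprDn [RHS](big_ord_widen N (binom_term x y k) kN) [RHS]big_mkcond /=.
apply: eq_bigr => i _; case: ltnP => // ki.
by rewrite /binom_term bin_small // mulr0n.
Qed.

Lemma rnMn (V : normedZmodType R[i]) (x : V) n : rn (x *+ n) = rn x *+ n.
Proof.
rewrite /rn normrMn; case: `|x| => a b; elim: n => // n.
by rewrite !mulrS; case: (_ *+ n) => c d /= ->.
Qed.

Lemma rn_binom_term (x y : R[i]) k n :
  rn (binom_term x y k n) = binom_term (rn x) (rn y) k n.
Proof. by rewrite /binom_term rnMn rnM !rnX. Qed.

Lemma sum_rn_binom_term (x y : R[i]) k N :
  \sum_(n < N) rn (binom_term x y k n) <= (rn x + rn y) ^+ k.
Proof.
have h n : 0 <= binom_term (rn x) (rn y) k n by rewrite -rn_binom_term rn_ge0.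
rewrite -(@sum_binom_term _ _ _ k (N + k.+1)); last by rewrite addnS ltnS leq_addl.
under eq_bigr do rewrite rn_binom_term.
rewrite big_split_ord /= lerDl; exact: sumr_ge0.
Qed.

Lemma rn_binom_term_le (x y : R[i]) k n : rn (binom_term x y k n) <= (rn x + rn y) ^+ k.
Proof.
apply: le_trans (sum_rn_binom_term x y k n.+1); rewrite big_ord_recr /= lerDr.
by apply: sumr_ge0 => i _; exact: rn_ge0.
Qed.

Lemma cvg_sum (V : normedModType R[i]) (N : nat) (u : nat -> nat -> V) (l : nat -> V) :
  (forall n, u n @ \oo --> l n) ->
  (fun k => \sum_(n < N) u n k) @ \oo --> \sum_(n < N) l n.
Proof.
move=> h; elim: N => [|N IH].
  rewrite big_ord0; under eq_fun do rewrite big_ord0; exact: cvg_cst.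
rewrite big_ord_recr; under eq_fun do rewrite big_ord_recr.
exact: cvgD.
Qed.

(** Re-expansion at [l] by the binomial theorem: the double series is dominated by a geometric
    series of ratio [(rn l + rn h) * K], which is below 1 as long as [rn l + rn h] is less than
    [r]. *)
Lemma ps_analytic (V : completeNormedModType R[i]) (a : nat -> V) (C K : R)
    (f : R[i]^o -> V) (r : R) :
  0 <= C -> 0 < K -> (forall n, rn (a n) <= C * K ^+ n) -> r <= K^-1 ->
  (forall w, rn w < r -> series (fun n => w ^+ n *: a n) @ \oo --> f w) ->
  forall l, rn l < r -> analytic_at f l.
Proof.
move=> C0 K0 aCK rK fE l lr.
pose q (h : R[i]) := (rn l + rn h) * K.
have q0 h : 0 <= q h by rewrite mulr_ge0 ?addr_ge0 ?rn_ge0 // ltW.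
have q1 h : rn h < r - rn l -> q h < 1.
  move=> hr; rewrite /q -ltr_pdivlMr // div1r; lra.
pose t (h : R[i]) n k : V := binom_term l h k n *: a k.
have tE h n k : t h n k = h ^+ n *: ((l ^+ (k - n) *+ 'C(k, n)) *: a k).
  by rewrite /t /binom_term scalerA mulrnAr mulrC.
have t_le h n k : rn (t h n k) <= C * q h ^+ k.
  rewrite rnZ /q exprMn mulrCA ler_pM ?rn_ge0 //.
  exact: rn_binom_term_le.
have dex n : exists d : V, series (fun k => (l ^+ (k - n) *+ 'C(k, n)) *: a k) @ \oo --> d.
  (* An auxiliary nonzero increment within the admissible radius: the [n]-th new coefficient
     converges because it does so after multiplication by [h0 ^+ n]. *)
  pose h0 : R[i] := ((r - rn l) / 2)%:C.
  have rh0 : rn h0 = (r - rn l) / 2 by rewrite rnC gtr0_norm //; lra.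
  have h00 : h0 != 0 by rewrite -rn_gt0 rh0; lra.
  have qh0 : q h0 < 1 by apply: q1; rewrite rh0; lra.
  have [x tx] := series_geom_cvg (q0 h0) qh0 (t_le h0 n).
  exists (h0 ^- n *: x).
  have -> : series (fun k => (l ^+ (k - n) *+ 'C(k, n)) *: a k) =
      fun m => h0 ^- n *: series (t h0 n) m.
    apply/funext => m; rewrite /series /= scaler_sumr; apply: eq_bigr => k _.
    by rewrite tE scalerA mulVf ?scale1r // expf_neq0.
  exact: cvgZl_tmp.
have [d dP] := choice dex.
apply/analytic_atP; exists d, (r - rn l); first by lra.
move=> h hr; apply/cvg_rnP => e e0.
have [N hN] := geom_small (2 * C / (1 - q h)) (q0 h) (q1 h hr) e0.
exists N => m /hN; apply: le_lt_trans.
have lh : rn (l + h) < r by have := ler_rnD l h; lra.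
(* The error of the first [m] new terms, sorted by the old index [k]. It vanishes for [k < m], where
   the binomial sum is complete, so only a geometric tail from [m] on remains. *)
pose u k := (l + h) ^+ k *: a k - \sum_(n < m) t h n k.
have tcvg n : series (t h n) @ \oo --> h ^+ n *: d n.
  have -> : series (t h n) =
      fun j => h ^+ n *: series (fun k => (l ^+ (k - n) *+ 'C(k, n)) *: a k) j.
    apply/funext => j; rewrite /series /= scaler_sumr.
    by apply: eq_bigr => k _; exact: tE.
  exact: cvgZl_tmp.
have ucvg : series u @ \oo --> f (l + h) - series (fun n => h ^+ n *: d n) m.
  have -> : series u = fun j => series (fun k => (l + h) ^+ k *: a k) j -
      \sum_(n < m) series (t h n) j.
    apply/funext => j; rewrite /series /= /u sumrB; congr (_ - _).
    by rewrite exchange_big.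
  apply: cvgB; first exact: fE.
  rewrite [X in _ --> X]/series /= big_mkord.
  exact: (cvg_sum (u := fun n => series (t h n)) (N := m) tcvg).
have u0 k : (k < m)%N -> u k = 0.
  by move=> km; rewrite /u -scaler_suml sum_binom_term // subrr.
have ub k : (m <= k)%N -> rn (u k) <= 2 * C * q h ^+ k.
  move=> _; apply: (le_trans (ler_rnB _ _)).
  have h1 : rn ((l + h) ^+ k *: a k) <= C * q h ^+ k.
    rewrite rnZ rnX /q exprMn mulrCA ler_pM ?rn_ge0 ?exprn_ge0 ?rn_ge0 //.
    by rewrite lerXn2r ?nnegrE ?rn_ge0 ?addr_ge0 ?rn_ge0 ?ler_rnD.
  have h2 : rn (\sum_(n < m) t h n k) <= C * q h ^+ k.
    rewrite -scaler_suml rnZ /q exprMn mulrCA ler_pM ?rn_ge0 //.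
    exact: le_trans (ler_rn_sum _ _) (sum_rn_binom_term l h k m).
  lra.
have := series_geom_tail (q0 h) (q1 h hr) ub ucvg.
have -> : series u m = 0.
  by rewrite /series /= big_nat big1 // => k /andP[_ /u0].
by rewrite sub0r rnN mulrAC.
Qed.

Lemma analytic_zero_near (V : normedModType R[i]) (f : R[i]^o -> V) z :
  analytic_at f z ->
  (forall e : R, 0 < e -> exists w : R[i], 0 < rn w < e /\ f (z + w) = 0) ->
  exists2 e : R, 0 < e & forall w, rn w < e -> f (z + w) = 0.
Proof.
move=> /analytic_atP[a [r r0 ar]] zeros; exists r => // w wr.
have a0 : forall n, a n = 0.
  apply: ps_uniq => e e0; have [|w' [w'e fw']] := zeros (Num.min e r).
    by rewrite lt_min e0.
  move: w'e; rewrite lt_min => /and3P[w0 we wr']; exists w'.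
  by rewrite w0 we; split=> //; rewrite -fw'; exact: ar.
apply: cvg_rn_unique (ar w wr) _.
have -> : series (fun n => w ^+ n *: a n) = fun=> 0.
  by apply/funext => n; rewrite /series /= big1 // => i _; rewrite a0 scaler0.
exact: cvg_cst.
Qed.

(** A disc is star-shaped about its centre, so vanishing is propagated along the segment to
    [l0 + v]: zeros accumulate at the last parameter reached, hence [f] vanishes around that point
    and the segment can be continued. *)
Lemma identity_theorem (V : normedModType R[i]) (f : R[i]^o -> V) (l0 : R[i]^o) (r e : R) :
  (forall w, rn w < r -> analytic_at f (l0 + w)) ->
  0 < e -> (forall w, rn w < e -> f (l0 + w) = 0) ->
  forall w, rn w < r -> f (l0 + w) = 0.
Proof.
move=> fan e0 fe v vr.
have [->|v0] := eqVneq v 0; first by apply: fe; rewrite rn0.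
have rv : 0 < rn v by rewrite rn_gt0.
pose G := [set t : R | 0 <= t <= 1 /\
  forall s, 0 <= s <= t -> f (l0 + s%:C * v) = 0].
have rnsv s : 0 <= s -> rn (s%:C * v) = s * rn v by move=> s0; rewrite rnM rnC ger0_norm.
pose d := Num.min 1 (e / (2 * rn v)).
have d0 : 0 < d by rewrite lt_min ltr01 divr_gt0 // mulr_gt0.
have d1 : d <= 1 by rewrite ge_min lexx.
have Gd : G d.
  split=> [|s /andP[s0 sd]]; first by rewrite d1 ltW.
  apply: fe; rewrite rnsv //; apply: (@le_lt_trans _ _ (e / 2)); last by lra.
  have : s <= e / (2 * rn v) by apply: (le_trans sd); rewrite /d ge_min lexx orbT.
  by rewrite invfM mulrA ler_pdivlMr.
have G1 : ubound G 1 by move=> t [/andP[]].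
have supG : has_sup G by split; [exists d|exists 1].
set t := sup G; have dt : d <= t by apply: ub_le_sup => //; exists 1.
have t1 : t <= 1 by apply: ge_sup => //; exists d.
have below s : 0 <= s -> s < t -> f (l0 + s%:C * v) = 0.
  move=> s0 st; have ts : 0 < t - s by lra.
  have [u [_ Gu] su] := sup_adherent ts supG.
  by apply: Gu; rewrite s0; rewrite -/t in su; lra.
have tv : rn (t%:C * v) < r.
  by rewrite rnsv; [nra|lra].
have [g0 gpos gP] : exists2 g, 0 < g & forall w, rn w < g -> f (l0 + t%:C * v + w) = 0.
  apply: analytic_zero_near; first exact: fan.
  move=> g gpos; pose h := Num.min (t / 2) (g / (2 * rn v)).
  have h0 : 0 < h by rewrite lt_min !divr_gt0 ?mulr_gt0 //; lra.
  have ht : h <= t / 2 by rewrite ge_min lexx.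
  have hg : h * rn v <= g / 2.
    have : h <= g / (2 * rn v) by rewrite ge_min lexx orbT.
    by rewrite invfM mulrA ler_pdivlMr.
  exists (- (h%:C * v)); rewrite rnN rnsv; last by lra.
  rewrite mulr_gt0 //; split; first by lra.
  by rewrite -addrA -mulrBl -rmorphB; apply: below; lra.
have upto s : 0 <= s -> s < t + g0 / rn v -> f (l0 + s%:C * v) = 0.
  move=> s0 sg; have [st|ts] := ltrP s t; first exact: below.
  have -> : l0 + s%:C * v = l0 + t%:C * v + (s - t)%:C * v.
    by rewrite -addrA -mulrDl -rmorphD /= (addrC t) subrK.
  apply: gP; rewrite rnsv; last by lra.
  by rewrite -ltr_pdivlMr //; lra.
have gv : 0 < g0 / rn v by rewrite divr_gt0.
have [t1'|t1'] := ltrP t 1; last first.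
  by rewrite -[v]mul1r; apply: upto; lra.
(* Half of the gained length is used, since [upto] is strict while [G] asks for vanishing up to and
   including its parameter. *)
pose t' := Num.min 1 (t + g0 / (2 * rn v)).
have g2 : g0 / (2 * rn v) = g0 / rn v / 2 by rewrite invfM mulrCA mulrC.
have tt' : t < t' by rewrite lt_min t1' /= ltrDl g2; lra.
exfalso; suff : t' <= t by lra.
apply: ub_le_sup; first by exists 1.
have t'1 : t' <= 1 by rewrite ge_min lexx.
have t'g : t' <= t + g0 / (2 * rn v) by rewrite ge_min lexx orbT.
split=> [|s /andP[s0 st']]; first by apply/andP; split; lra.
by apply: upto => //; rewrite g2 in t'g; lra.
Qed.

(** Injectivity of [T - w] forces [f w = 0], so [f] has zeros accumulating at 0 and the identity
    theorem applies. *)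
Lemma svep_of_injective (V : normedModType R[i]) (T : bop V V) :
  (forall e : R, 0 < e -> exists w : R[i], 0 < rn w < e /\
     forall x, (T - w *: (1 : bop V V)) x = 0 -> x = 0) ->
  svep T 0.
Proof.
move=> inj r f r0 fan fE.
have [d d0 rd] := gt0_complexP r0.
have ballE l : ball (0 : R[i]^o) r l <-> rn l < d.
  by rewrite -ball_normE /= sub0r normrN rnE rd ltcR.
have [||e e0 fe] := @analytic_zero_near V f 0.
- by apply/fan/ballE; rewrite rn0.
- move=> e e0; have [|w [we wP]] := inj (Num.min e d); first by rewrite lt_min e0.
  move: we; rewrite lt_min => /and3P[w0 we wd]; exists w; rewrite w0 we add0r.
  by split=> //; apply/wP/fE/ballE.
move=> l /ballE ld; rewrite -[l]add0r.
apply: (@identity_theorem V f 0 d e) => // w wd.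
by apply/fan/ballE; rewrite add0r.
Qed.

Lemma svep_chain (V : completeNormedModType R[i]) (T : bop V V) (x : nat -> V) (C K : R) :
  svep T 0 -> 0 <= C -> 0 < K -> T (x 0) = 0 -> (forall k, T (x k.+1) = x k) ->
  (forall k, rn (x k) <= C * K ^+ k) -> x 0 = 0.
Proof.
move=> sT C0 K0 T0 TS xCK.
pose r := (2 * K)^-1.
have r0 : 0 < r by rewrite invr_gt0 mulr_gt0.
have conv w : exists y : V, rn w < r -> series (fun n => w ^+ n *: x n) @ \oo --> y.
  have [wr|] := ltrP (rn w) r; last by exists 0.
  have wK : rn w * K < 1.
    by move: wr; rewrite /r invfM ltr_pdivlMr //; lra.
  have wK0 : 0 <= rn w * K by rewrite mulr_ge0 ?rn_ge0 // ltW.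
  by have [y wy] := series_geom_cvg wK0 wK (ps_geom w C0 K0 xCK); exists y.
have [f fP] := choice conv.
have rK : r <= K^-1.
  by rewrite /r invfM ler_piMl ?invr_ge0 ?ltW //; lra.
have r0' : 0 < r%:C :> R[i] by rewrite ltcR.
have ballE l : ball (0 : R[i]^o) r%:C l <-> rn l < r.
  by rewrite -ball_normE /= sub0r normrN rnE ltcR.
have f0 : f 0 = 0.
  apply: (sT r%:C f r0') => [l /ballE lr|l /ballE lr|].
  - exact: (ps_analytic C0 K0 xCK rK fP).
  - rewrite bopDE bopNE bopZE bop1E; apply/eqP; rewrite subr_eq0; apply/eqP.
    (* The partial sums are shifted by one because [T] kills [x 0] and lowers the other indices: it
       maps the sum of [n.+1] terms to [l] times the sum of [n] terms. *)
    have h1 := cvg_bop (T := T) (fP l lr); rewrite -cvg_shiftS /= in h1.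
    apply: cvg_rn_unique h1 _.
    have -> : (fun n => T (series (fun n => l ^+ n *: x n) n.+1)) =
        fun n => l *: series (fun n => l ^+ n *: x n) n.
      apply/funext => n; rewrite /series /= linear_sum big_nat_recl //=.
      rewrite linearZ /= T0 scaler0 add0r scaler_sumr.
      by apply: eq_bigr => i _; rewrite linearZ /= TS exprS scalerA.
    by apply: cvgZl_tmp; exact: fP.
  - by apply/ballE; rewrite rn0.
rewrite -f0; have r00 : rn (0 : R[i]) < r by rewrite rn0.
apply: cvg_rn_unique _ (fP 0 r00); apply/cvg_rnP => e e0; exists 1%N => -[//|n] _.
rewrite /series /= big_nat_recl // big1 ?addr0 => [|i _].
  by rewrite scale1r subrr rn0.
by rewrite exprS mul0r scale0r.
Qed.

End Expansion.

(** * The Hahn-Banach theorem *)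

Section HahnBanach.
Context {R : realType} {X : normedModType R[i]}.
Variable K : R.
Hypothesis K0 : 0 <= K.

(** Partial functionals are encoded as graphs, so that extension is inclusion. Single-valuedness is
    not imposed: it follows from linearity and domination, as the difference of two values at one
    point is a value at 0. *)
Definition dominated_graph (G : set (X * R)) :=
  (forall t x a y b, G (x, a) -> G (y, b) -> G (t%:C *: x + y, t * a + b)) /\
  (forall x a, G (x, a) -> a <= K * rn x).

Lemma dominated_graph_extend (G : set (X * R)) x : dominated_graph G -> G (0, 0) ->
  exists G' c, [/\ dominated_graph G', G `<=` G' & G' (x, c)].
Proof.
move=> [Glin Gdom] G00.
have GD y a z b : G (y, a) -> G (z, b) -> G (y + z, a + b).
  by move=> Gy Gz; have := Glin 1 _ _ _ _ Gy Gz; rewrite scale1r mul1r.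
have GZ t y a : G (y, a) -> G (t%:C *: y, t * a).
  by move=> Gy; have := Glin t _ _ _ _ Gy G00; rewrite !addr0.
(* The lower constraints on the value at [x]; each lies below every upper constraint by the triangle
   inequality, so their supremum is admissible. *)
pose B := [set v : R | exists y a, G (y, a) /\ v = a - K * rn (y - x)].
have bound z b : G (z, b) -> ubound B (K * rn (z + x) - b).
  move=> Gz _ [y [a [Gy ->]]]; have := Gdom _ _ (GD _ _ _ _ Gy Gz).
  have := ler_wpM2l K0 (ler_rnD (y - x) (z + x)).
  by rewrite addrACA addNr addr0 mulrDr; lra.
have supB : has_sup B.
  split; first by exists (0 - K * rn (0 - x)), 0, 0.
  by exists (K * rn (0 + x) - 0); exact: bound.
pose c := sup B.
have up z b : G (z, b) -> b + c <= K * rn (z + x).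
  move=> Gz; have : c <= K * rn (z + x) - b.
    by apply: ge_sup; [case: supB|exact: bound].
  lra.
have down z b : G (z, b) -> b - c <= K * rn (z - x).
  move=> Gz; have : b - K * rn (z - x) <= c.
    by apply: ub_le_sup; [case: supB|exists z, b].
  lra.
exists [set v | exists y a t, G (y, a) /\ v = (y + t%:C *: x, a + t * c)], c; split.
- split.
    move=> t _ _ _ _ [y [a [s [Gy [-> ->]]]]] [z [b [r [Gz [-> ->]]]]].
    exists (t%:C *: y + z), (t * a + b), (t * s + r); split; first exact: Glin.
    congr (_, _); last by ring.
    by rewrite scalerDr scalerA -rmorphM addrACA -scalerDl -rmorphD.
  move=> _ _ [y [a [t [Gy [-> ->]]]]].
  have [t0|t0|->] := ltgtP t 0; last by rewrite mul0r scale0r !addr0; exact: Gdom.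
    have t0' : 0 < - t by lra.
    have tN : (- t)%:C != 0 by rewrite (inj_eq (@complexI R)) lt0r_neq0.
    have := down _ _ (GZ (- t)^-1 _ _ Gy).
    have -> : y + t%:C *: x = (- t)%:C *: ((- t)^-1%:C *: y - x).
      rewrite scalerBr scalerA -rmorphM /= mulfV ?lt0r_neq0 // scale1r.
      by rewrite -scaleNr -rmorphN opprK.
    move=> h; rewrite rnZ rnC gtr0_norm //.
    have -> : a + t * c = - t * ((- t)^-1 * a - c).
      by field; rewrite lt_eqF.
    by rewrite mulrCA ler_wpM2l // ltW.
  have := up _ _ (GZ t^-1 _ _ Gy).
  have -> : y + t%:C *: x = t%:C *: (t^-1%:C *: y + x).
    by rewrite scalerDr scalerA -rmorphM /= mulfV ?lt0r_neq0 // scale1r.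
  move=> h; rewrite rnZ rnC gtr0_norm //.
  have -> : a + t * c = t * (t^-1 * a + c) by field; rewrite lt0r_neq0.
  by rewrite mulrCA ler_wpM2l // ltW.
- by move=> [y a] Gy; exists y, a, 0; rewrite mul0r scale0r !addr0.
- by exists 0, 0, 1; rewrite scale1r mul1r !add0r.
Qed.

Lemma hahn_banach_real (G0 : set (X * R)) : dominated_graph G0 -> G0 (0, 0) ->
  exists U : X -> R, [/\ forall x a, G0 (x, a) -> U x = a,
    forall t x y, U (t%:C *: x + y) = t * U x + U y &
    forall x, U x <= K * rn x].
Proof.
move=> dG0 G00.
(* [G0] is adjoined to [A] instead of being required inside it, so that the empty chain, whose union
   is empty, is covered too. *)
have [|A [[Alin Adom] Amax]] := @Zorn_bigcup _ [set A | dominated_graph (A `|` G0)].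
  move=> F FP Ftot; split.
    have pair u v : (\bigcup_(A in F) A `|` G0) u -> (\bigcup_(A in F) A `|` G0) v ->
        (exists2 A, F A & (A `|` G0) u /\ (A `|` G0) v) \/ (G0 u /\ G0 v).
      move=> [[A FA Au]|Gu] [[B FB Bv]|Gv].
      - have [AB|BA] := Ftot _ _ FA FB.
          by left; exists B => //; split; left => //; exact: AB.
        by left; exists A => //; split; left => //; exact: BA.
      - by left; exists A => //; split; [left|right].
      - by left; exists B => //; split; [right|left].
      - by right.
    move=> t x a y b Gx Gy; have [[A FA [Ax Ay]]|[Gx' Gy']] := pair _ _ Gx Gy.
      have [] := (FP _ FA).1 t _ _ _ _ Ax Ay; last by right.
      by left; exists A.
    by right; exact: dG0.1.
  move=> x a [[A FA Ax]|]; last exact: dG0.2.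
  by apply: (FP _ FA).2; left.
set G := A `|` G0 in Alin Adom.
have total x : exists a, G (x, a).
  have [||G' [c [dG' GG' Gx]]] := @dominated_graph_extend G x; [by []|by right|].
  exists c; apply: contrapT => nGx; apply: (Amax G').
    split; last by move=> h; apply: nGx; left; exact: h.
    by move=> v Av; apply: GG'; left.
  have -> : [set A0 | dominated_graph (A0 `|` G0)] G' = dominated_graph (G' `|` G0) by [].
  by rewrite setUidl // => v Gv; apply: GG'; right.
have [U UG] := choice total.
have uniq x a b : G (x, a) -> G (x, b) -> a = b.
  have half u v : G (x, u) -> G (x, v) -> u <= v.
    move=> Gu Gv; have := Adom _ _ (Alin (- 1) _ _ _ _ Gv Gu).
    by rewrite rmorphN1 scaleN1r addNr rn0 mulr0 mulN1r; lra.
  by move=> Ga Gb; apply/eqP; rewrite eq_le !half.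
exists U; split=> [x a Gx|t x y|x].
- by apply: uniq (UG x) _; right.
- by apply: uniq (UG _) _; exact: Alin.
- exact: Adom.
Qed.

Lemma hahn_banach (M : set X) (psi : X -> R[i]) : M 0 ->
  (forall a x y, M x -> M y -> M (a *: x + y) /\ psi (a *: x + y) = a * psi x + psi y) ->
  (forall x, M x -> rn (psi x) <= K * rn x) ->
  exists2 phi : bop X R[i]^o, forall x, M x -> phi x = psi x & rn phi <= K.
Proof.
move=> M0 Mlin psiK.
have psi0 : psi 0 = 0.
  have [_] := Mlin 1 0 0 M0 M0; rewrite scale1r addr0 mul1r.
  by move=> /eqP; rewrite -subr_eq0 opprD addNKr oppr_eq0 => /eqP.
pose G0 := [set v : X * R | M v.1 /\ v.2 = complex.Re (psi v.1)].
have [||U [UG Ulin Udom]] := @hahn_banach_real G0.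
- split=> [t x a y b [/= Mx ->] [/= My ->]|x a [/= Mx ->]].
    have [Mxy psiE] := Mlin t%:C _ _ Mx My; split=> //=; rewrite psiE.
    by case: (psi x) => ? ?; case: (psi y) => ? ? /=; rewrite mul0r subr0.
  by apply: le_trans (psiK x Mx); apply: le_trans (rnRe _); exact: ler_norm.
- by split=> //=; rewrite psi0.
have UM x : M x -> U x = complex.Re (psi x) by move=> Mx; exact: UG.
have U0 : U 0 = 0 by rewrite UM // psi0.
have UD x y : U (x + y) = U x + U y by have := Ulin 1 x y; rewrite scale1r mul1r.
have UZ t x : U (t%:C *: x) = t * U x by have := Ulin t x 0; rewrite !addr0 U0 addr0.
have UN x : U (- x) = - U x by have := UZ (- 1) x; rewrite rmorphN1 scaleN1r mulN1r.
have UZc a x : U (a *: x) = complex.Re a * U x + complex.Im a * U ('i%C *: x).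
  rewrite {1}[a]complexE scalerDl UD UZ; congr (_ + _).
  by rewrite mulrC -scalerA UZ.
(* A complex linear functional is determined by its real part; this is the one with real part
   [U]. *)
pose phi x : R[i]^o := U x +i* - U ('i%C *: x).
have phi_lin : linear phi.
  move=> a x y; rewrite /phi.
  have -> : 'i%C *: (a *: x + y) = a *: ('i%C *: x) + 'i%C *: y.
    by rewrite scalerDr !scalerA mulrC.
  have iix : 'i%C *: ('i%C *: x) = - x by rewrite scalerA -expr2 sqr_i scaleN1r.
  rewrite !UD (UZc a x) (UZc a ('i%C *: x)) iix UN.
  rewrite -[a *: _]/(a * _).
  case: a => s t; apply/eqP; rewrite eq_complex /=; apply/andP.
  by split; apply/eqP; ring.
have phiZ a x : phi (a *: x) = a * phi x.
  have := phi_lin a x 0; rewrite !addr0 => ->.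
  have -> : phi 0 = 0 by have := phi_lin (-1) 0 0; rewrite scaler0 addr0 scaleN1r addNr.
  by rewrite addr0.
have phi_le x : rn (phi x) <= K * rn x.
  have [->|z0] := eqVneq (phi x) 0; first by rewrite rn0 mulr_ge0 ?rn_ge0.
  (* Rotating [x] by this unimodular scalar makes the value of [phi] real and nonnegative, so the
     bound on [U] bounds the modulus with the same constant. *)
  pose u : R[i] := (rn (phi x))%:C / phi x.
  have ru : rn u = 1.
    by rewrite rnM rnV rnC ger0_norm ?rn_ge0 // mulfV // rn_eq0P.
  have uE : phi (u *: x) = (rn (phi x))%:C by rewrite phiZ divfK.
  have := Udom (u *: x); rewrite rnZ ru mul1r; apply: le_trans.
  by have := congr1 (@complex.Re R) uE; rewrite /= => ->.
have [Phi PhiE] := bop_rnP phi_lin K0 phi_le.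
exists Phi => [x Mx|]; last by apply: rn_bop_le => // x; rewrite PhiE.
rewrite PhiE /phi UM // UM; last by have [+ _] := Mlin 'i%C x 0 Mx M0; rewrite addr0.
have [_] := Mlin 'i%C x 0 Mx M0; rewrite !addr0 psi0 addr0 => ->.
by rewrite mulrC ReiNIm opprK; case: (psi x).
Qed.

End HahnBanach.

(** * Kato operators *)

Section Kato.
Context {R : realType}.

(** Open mapping for [T] onto its range, which is complete because it is closed. The second operator
    given to [open_mapping2] is 0, and 1 is added to its constant to make it positive. *)
Lemma closed_range_lift (V : completeNormedModType R[i]) (T : bop V V) :
  closed (range T) ->
  exists2 C : R, 0 < C & forall y, range T y -> exists2 x, T x = y & rn x <= C * rn y.
Proof.
move=> cT; set Y := range_csub cT.
have cod x : exists y : csub Y, csub_incl Y y = T x.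
  by apply: csub_incl_ex; exists x.
have [g gE] := choice cod.
have [G GE] : exists G : bop V (csub Y), forall x, G x = g x.
  apply: (bop_rnP (k := rn T)) => [a x y||x]; [|exact: rn_ge0|].
    by apply: csub_incl_inj; rewrite gE linearP /= -!gE.
  by rewrite (_ : rn (g x) = rn (T x)) ?rn_bop // -gE.
have [|C C0 CP] := @open_mapping2 R V V (csub Y) G 0.
  move=> y; have [x _ xy] := csub_incl_in y; exists x, 0; rewrite linear0 addr0 GE.
  by apply: csub_incl_inj; rewrite gE.
exists (C + 1) => [|y Ty]; first by lra.
have [u uy] := csub_incl_ex (Ty : csub_set Y y).
have [x [x' [uE xC _]]] := CP u; exists x.
  by rewrite -uy uE bop0E addr0 GE gE.
apply: (le_trans xC); rewrite (_ : rn u = rn y) ?ler_wpM2r ?rn_ge0 //; first by lra.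
by rewrite -uy.
Qed.

Lemma bijective_invertible (V : completeNormedModType R[i]) (T : bop V V) :
  (forall x, T x = 0 -> x = 0) -> range T = setT -> invertible T.
Proof.
move=> inj surj.
have onto y : exists x, y = T x.
  by have : range T y by [rewrite surj]; move=> [x _ <-]; exists x.
have [||B [BT _]] := @bop_factor R V V V V T 0 1 0.
- by move=> y; have [x ->] := onto y; exists x, 0; rewrite linear0 addr0.
- by move=> x y; rewrite !bop0E !addr0 => /inj ->; rewrite linear0.
exists B; split; apply: bop_ext => x; first by rewrite bopME BT.
by have [y ->] := onto x; rewrite bopME BT.
Qed.

(* For a Kato operator every preimage of a vector in the range of all powers of
   [T] is again in the range of all powers, so a kernel vector starts an
   infinite backward orbit. *)
Lemma kato_chain (V : completeNormedModType R[i]) (T : bop V V) x0 :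
  kato T -> T x0 = 0 ->
  exists (x : nat -> V) (C : R), [/\ x 0 = x0, 0 < C, forall k, T (x k.+1) = x k &
    forall k, rn (x k) <= rn x0 * C ^+ k].
Proof.
move=> [cT kerT] Tx0; have [C C0 lift] := closed_range_lift cT.
have step y : exists x, (forall n, range (T ^+ n) y) ->
    [/\ forall n, range (T ^+ n) x, T x = y & rn x <= C * rn y].
  have [yR|] := pselect (forall n, range (T ^+ n) y); last by exists 0.
  have [x xy xC] := lift y (yR 1); exists x => _; split=> // n.
  (* [T] sends both [x] and [(T ^+ n) z] to [y], so they differ by a kernel vector, which the Kato
     condition places in the range of [T ^+ n]. *)
  have [z _ zy] := yR n.+1.
  have [u _ uE] : range (T ^+ n) (x - (T ^+ n) z).
    by apply: kerT; apply/bkerP; rewrite linearB /= xy -bopME -exprS zy subrr.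
  by exists (u + z) => //; rewrite linearD /= uE subrK.
have [f fP] := choice step.
pose x k := iter k f x0.
have xR k n : range (T ^+ n) (x k).
  elim: k n => [|k IH] n; first exact: kerT.
  by have [+ _ _] := fP _ IH; exact.
exists x, C; split=> // k; first by have [] := fP _ (xR k).
elim: k => [|k IH]; first by rewrite expr0 mulr1.
have [_ _ /le_trans] := fP _ (xR k); apply.
by rewrite exprS mulrCA ler_pM2l.
Qed.

(** On the span of [A] and [y], the coefficient of [y] is a functional of norm at most [d^-1], where
    [d] is a positive lower bound for the distance from [y] to [A]. The same estimate makes the
    chosen coordinate unique. *)
Lemma closed_separation (V : normedModType R[i]) (A : csubspace V) y :
  ~ csub_set A y ->
  exists phi : bop V R[i]^o, (forall x, csub_set A x -> phi x = 0) /\ phi y = 1.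
Proof.
move=> Ay.
have [d d0 dA] : exists2 d : R, 0 < d & forall x, csub_set A x -> d <= rn (y - x).
  apply: contrapT => h; apply: Ay; move/closed_rnP: (csub_closed (c := A)); apply=> e e0.
  apply: contrapT => h'; apply: h; exists e => // x Ax; rewrite leNgt; apply/negP => xe.
  by apply: h'; exists x.
have AN a x : csub_set A x -> csub_set A (a *: x).
  by move=> Ax; have := csub_lin a Ax (csub0 A); rewrite addr0.
have low a x : csub_set A x -> rn a * d <= rn (x + a *: y).
  move=> Ax; have [->|a0] := eqVneq a 0; first by rewrite rn0 mul0r rn_ge0.
  have -> : x + a *: y = a *: (y - (- a^-1) *: x).
    by rewrite scalerBr scaleNr scalerN opprK scalerA mulfV // scale1r addrC.
  by rewrite rnZ ler_wpM2l ?rn_ge0 //; apply: dA; exact: AN.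
pose M := [set v | exists a x, csub_set A x /\ v = x + a *: y].
have coord v : exists a, M v -> exists2 x, csub_set A x & v = x + a *: y.
  have [[a [x [Ax ->]]]|] := pselect (M v); last by exists 0.
  by exists a => _; exists x.
have [psi psiP] := choice coord.
have psiE a x : csub_set A x -> psi (x + a *: y) = a.
  move=> Ax; have Mv : M (x + a *: y) by exists a, x.
  have [x' Ax' /eqP] := psiP _ Mv; rewrite -subr_eq0 opprD addrACA -scalerBl => /eqP E.
  have := low (a - psi (x + a *: y)) (x - x').
  rewrite E rn0 => h; apply/esym/eqP; rewrite -subr_eq0; apply/eqP/rn_eq0.
  have : rn (a - psi (x + a *: y)) * d <= 0.
    by apply: h; rewrite -[x]scale1r -scaleN1r addrC; apply: csub_lin => //; rewrite scale1r.
  by rewrite pmulr_lle0.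
have M0 : M 0 by exists 0, 0; rewrite scale0r addr0; split=> //; exact: csub0.
have [|||phi phiE _] := @hahn_banach R V d^-1 _ M psi M0.
- by rewrite invr_ge0 ltW.
- move=> a v w [b [x [Ax ->]]] [c [z [Az ->]]].
  have -> : a *: (x + b *: y) + (z + c *: y) = (a *: x + z) + (a * b + c) *: y.
    by rewrite scalerDr scalerA addrACA -scalerDl.
  have Axz : csub_set A (a *: x + z) by exact: csub_lin.
  by split; [exists (a * b + c), (a *: x + z)|rewrite !psiE].
- move=> v [a [x [Ax ->]]]; rewrite psiE // ler_pdivlMl // mulrC.
  exact: low.
exists phi; split=> [x Ax|].
  have Mx : M x by exists 0, x; rewrite scale0r addr0.
  by rewrite phiE //; have := psiE 0 x Ax; rewrite scale0r addr0.
have My : M y by exists 1, 0; rewrite scale1r add0r; split=> //; exact: csub0.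
by rewrite phiE //; have := psiE 1 0 (csub0 A); rewrite scale1r add0r.
Qed.

(** One backward step for the adjoint: [phi] composed with the inverse of [T] on its range is
    bounded by the lifting constant and extends by Hahn-Banach. Iterated, it gives an orbit of
    geometric growth. *)
Lemma dual_lift (V : completeNormedModType R[i]) (T : bop V V) (C : R)
    (phi : bop V R[i]^o) : 0 < C ->
  (forall y, range T y -> exists2 x, T x = y & rn x <= C * rn y) ->
  (forall x, T x = 0 -> x = 0) ->
  exists2 phi' : bop V R[i]^o, forall x, phi' (T x) = phi x & rn phi' <= C * rn phi.
Proof.
move=> C0 lift inj.
have pre y : exists x, range T y -> T x = y /\ rn x <= C * rn y.
  have [/lift[x xy xC]|] := pselect (range T y); last by exists 0.
  by exists x.
have [g gP] := choice pre.
have gT x : g (T x) = x.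
  have [|E _] := gP (T x); first by exists x.
  by apply/eqP; rewrite -subr_eq0; apply/eqP/inj; rewrite linearB /= E subrr.
have [||||phi' phiE bnd] := @hahn_banach R V (C * rn phi) _ (range T) (fun y => phi (g y)).
- by rewrite mulr_ge0 ?rn_ge0 // ltW.
- exact: range_bop0.
- move=> a _ _ [x _ <-] [y _ <-]; have E : a *: T x + T y = T (a *: x + y) by rewrite linearP.
  by rewrite E !gT; split; [exists (a *: x + y)|rewrite linearP].
- move=> y Ty; have [_ gC] := gP y Ty; apply: (le_trans (rn_bop phi (g y))).
  by rewrite [leRHS]mulrAC mulrC ler_wpM2r ?rn_ge0.
exists phi' => // x; by rewrite phiE ?gT //; exists x.
Qed.

Variable X : completeNormedModType R[i].
Implicit Type T : bop X X.

Lemma kato_svep_sum T : gen_kato_meromorphic T -> svep T 0 -> svep (adjoint T) 0 ->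
  invertible_meromorphic_sum T.
Proof.
move=> [d [kM mN]] sT sT'; exists d; split=> //.
have [s [_ _ sTM]] := red_split d; set T1 := restrM d in kM sTM *.
have inj x : T1 x = 0 -> x = 0.
  move=> T1x; have [u [C [u0 C0 uS uC]]] := kato_chain kM T1x.
  suff : inj1 s (u 0) = 0 by rewrite u0 => /(congr1 (prj1 s)); rewrite prj1K linear0.
  apply: (@svep_chain R X T (fun k => inj1 s (u k)) (rn (inj1 s) * rn x) C) => //.
  - by rewrite mulr_ge0 ?rn_ge0.
  - by rewrite sTM.1 u0 T1x linear0.
  - by move=> k; rewrite sTM.1 uS.
  - move=> k; apply: (le_trans (rn_bop _ _)); rewrite -mulrA.
    by apply: ler_wpM2l; [exact: rn_ge0|exact: uC].
apply: bijective_invertible => //; apply/seteqP; split=> // y _.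
have [cT1 _] := kM; apply: contrapT => yT1.
have [phi0 [phi0T phi0y]] := @closed_separation _ (range_csub cT1) y yT1.
have [C C0 lift] := closed_range_lift cT1.
have step (phi : bop (csub (redM d)) R[i]^o) : exists phi' : bop (csub (redM d)) R[i]^o,
    (forall x, phi' (T1 x) = phi x) /\ rn phi' <= C * rn phi.
  by have [phi' h1 h2] := dual_lift phi C0 lift inj; exists phi'.
have [f fP] := choice step.
pose phi k := iter k f phi0.
have phi_le k : rn (phi k) <= rn phi0 * C ^+ k.
  elim: k => [|k IH]; first by rewrite expr0 mulr1.
  have [_ /le_trans] := fP (phi k); apply.
  by rewrite exprS mulrCA ler_pM2l.
pose Phi k : dual X := bcomp (phi k) (prj1 s).
(* Composition with [prj1 s] intertwines the adjoints because the projection commutes with [T]. The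
   orbit starts at a functional that vanishes on the range of [T1] but not at [y]. *)
have PhiT k x : adjoint T (Phi k) x = phi k (T1 (prj1 s x)).
  by rewrite /= (splits_prj x sTM).1.
have Phi0 : Phi 0 = 0.
  apply: (@svep_chain R (complete_dual X) (adjoint T) Phi (rn phi0 * rn (prj1 s)) C) => //.
  - by rewrite mulr_ge0 ?rn_ge0.
  - by apply: bop_ext => x; rewrite PhiT phi0T //; exists (prj1 s x).
  - by move=> k; apply: bop_ext => x; rewrite PhiT /= (fP (phi k)).1.
  - move=> k; apply: rn_bop_le => [|x].
      by rewrite !mulr_ge0 ?rn_ge0 // exprn_ge0 // ltW.
    apply: (le_trans (rn_bop (phi k) _)).
    have -> : rn phi0 * rn (prj1 s) * C ^+ k * rn x =
      rn phi0 * C ^+ k * (rn (prj1 s) * rn x) by ring.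
    by apply: ler_pM; [exact: rn_ge0|exact: rn_ge0|exact: phi_le|exact: rn_bop].
have := congr1 (fun g : dual X => g (inj1 s y)) Phi0.
by rewrite /= prj1K phi0y => /eqP; rewrite oner_eq0.
Qed.

Lemma small_invertible T : ~ (spectrum T)° 0 ->
  forall e : R, 0 < e -> exists w : R[i], 0 < rn w < e /\
    invertible (T - w *: (1 : bop X X)).
Proof.
move=> nT e e0.
have [w we iw] : exists2 w : R[i], rn w < e & invertible (T - w *: (1 : bop X X)).
  apply: contrapT => h; apply: nT; apply/nbhs_rnP; exists e => // w.
  by rewrite sub0r rnN => we iw; apply: h; exists w.
(* The resolvent point found may be 0 itself; then [T] is invertible and nearby nonzero points are
   resolvent points as well. *)
have [w0|w0] := eqVneq w 0; last by exists w; rewrite rn_gt0 w0.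
have := invertible_drazin iw; rewrite w0 scale0r subr0.
move=> /drazin_punctured_invertible[r r0 rT].
have [|v] := @complex_small R (Num.min e r); first by rewrite lt_min e0.
rewrite rn_gt0 lt_min => /and3P[v0 ve vr]; exists v.
by rewrite rn_gt0 v0 ve; split=> //; exact: rT.
Qed.

Lemma not_interior_svep T : ~ (spectrum T)° 0 -> svep T 0 /\ svep (adjoint T) 0.
Proof.
move=> /small_invertible small; split; apply: svep_of_injective => e /small[w [we [S [ST TS]]]];
  exists w; split=> // x xw.
  by rewrite -[x]bop1E -ST bopME xw linear0.
apply: bop_ext => v.
(* A functional killed by the shifted adjoint vanishes on the range of [T - w], and [v] is the image
   of [S v]. *)
have <- : ((adjoint T - w *: (1 : bop (dual X) (dual X))) x : dual X) (S v) = x v.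
  rewrite -[in RHS](bop1E v) -TS bopME [(T - _) _]bopDE bopNE bopZE bop1E.
  have -> : x (T (S v) - w *: S v) = x (T (S v)) - w *: x (S v).
    by rewrite linearB /= linearZ.
  by [].
by rewrite xw.
Qed.

End Kato.

Theorem theorem2p4 (R : realType) (X : completeNormedModType R[i])
  (Xinf : ~ finite_dim [set: X]) (T : bop X X) :
  [<->
    (* i *) exists d : Red T, invertible (restrM d) /\ meromorphic (restrN d);
    (* ii *) gen_kato_meromorphic T /\ ~ (spectrum T)° 0;
    (* iii *) [/\ gen_kato_meromorphic T, svep T 0 & svep (adjoint T) 0];
    (* iv *) gen_drazin_meromorphic_invertible T;
    (* v *) meromorphic_quasi_polar T;
    (* vi *) exists P : bop X X, [/\ projection P, P * T = T * P,
      meromorphic (T * P) & b_browder (T + P)];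
    (* vii *) exists P : bop X X, [/\ projection P, P * T = T * P,
      meromorphic (T * P) & b_browder (T * (1 - P) + P)];
    (* viii *) exists d : Red T, b_browder (restrM d) /\ meromorphic (restrN d);
    (* ix *) gen_kato_meromorphic T /\ ~ limit_point (b_browder_spectrum T) 0;
    (* x *) gen_kato_meromorphic T /\ ~ (b_browder_spectrum T)° 0 ].
Proof.
have viii_i : (exists d : Red T, b_browder (restrM d) /\ meromorphic (restrN d)) ->
    invertible_meromorphic_sum T.
  by move=> /sum_drazin_meromorphic_inverse; exact: meromorphic_inverse_sum.
have iii_i : [/\ gen_kato_meromorphic T, svep T 0 & svep (adjoint T) 0] ->
    invertible_meromorphic_sum T.
  by move=> [kT sT sT']; exact: kato_svep_sum.
have ii_iii : gen_kato_meromorphic T /\ ~ (spectrum T)° 0 ->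
    [/\ gen_kato_meromorphic T, svep T 0 & svep (adjoint T) 0].
  by move=> [kT /not_interior_svep[]].
have i_iv : invertible_meromorphic_sum T -> gen_drazin_meromorphic_invertible T.
  by move=> /sum_invertible_drazin; exact: sum_drazin_meromorphic_inverse.
tfae.
- move=> iT; split; first exact: sum_kato.
  move=> /interior_b_browder_spectrum; apply: not_limit_point_not_interior.
  exact: sum_not_limit_point.
- exact: ii_iii.
- by move=> /iii_i/i_iv.
- by move=> /meromorphic_inverse_quasi_polar.
- move=> /meromorphic_inverse_quasi_polar/meromorphic_inverse_sum.
  exact: sum_projection_add.
(* The given [P] is not kept: it yields a decomposition with a B-Browder summand, which is improved
   to an invertible one before a new projection is formed. *)
- move=> [P [PP PT mTP bTP]]; apply/sum_projection_mul/viii_i.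
  by apply: (@projection_sum _ _ _ _ false PP PT mTP); rewrite mulr1.
- by move=> [P [PP PT mTP bTP]]; apply: (@projection_sum _ _ _ _ true PP PT mTP).
- by move=> /viii_i iT; split; [exact: sum_kato|exact: sum_not_limit_point].
- by move=> [kT lT]; split=> //; exact: not_limit_point_not_interior.
- move=> [kT nT]; apply/iii_i/ii_iii; split=> //.
  by move=> /interior_b_browder_spectrum.
Qed.
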